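(* Let $M$ be the Markov operator of the simple random walk on the Schreier graph of the action of Thompson's group $F$ on the orbit of $\frac12$, let $\eta$ be the spectral measure of the Laplace operator $\mathrm{Id}-M$ with respect to $\delta_{1/2}$, and let $N_{1/2}(s)=\eta((-\infty,s])$. Then there is a constant $C>0$ such that $$N_{1/2}(s)=Cs^{3/2}+O(s^2)\qquad\text{as } s\to0,\ s>0 .$$
   Context: Thompson's group $F$ is the group of homeomorphisms of $[0,1]$ generated by $a,b$, where $a(x)=x/2$ for $x\in[0,\frac12)$, $a(x)=x-\frac14$ for $x\in[\frac12,\frac34)$, $a(x)=2x-1$ for $x\in[\frac34,1]$; and $b(x)=x$ for $x\in[0,\frac12)$, $b(x)=\frac12a(2x-1)+\frac12$ for $x\in[\frac12,1]$. The Markov operator $M$ acts on $\ell^2(F\cdot\frac12)$ by $(Mf)(y)=\frac14\bigl(f(ay)+f(a^{-1}y)+f(by)+f(b^{-1}y)\bigr)$; it is bounded and self-adjoint. The spectral measure of a bounded self-adjoint operator with projection-valued spectral measure $E$ with respect to a vector $\xi$ is $B\mapsto(E(B)\xi,\xi)$. *)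

(* Defs.v *)
From HB Require Import structures.
From mathcomp Require Import all_boot all_order all_algebra.
From mathcomp Require Import all_classical all_reals all_analysis.
From mathcomp Require Export complex.
From mathcomp Require Import lra.

Set Implicit Arguments.
Unset Strict Implicit.
Unset Printing Implicit Defensive.
Import Order.TTheory GRing.Theory Num.Theory.
Import numFieldNormedType.Exports.

Local Open Scope classical_set_scope.
Local Open Scope ring_scope.

Section ThompsonGroup.
Variable R : realType.

Definition unit_interval : Type := {x : R | x \in `[0, 1]}.
HB.instance Definition _ := Choice.on unit_interval.
Implicit Types (x : R) (y : unit_interval).

Definition a_fun x : R :=
  if x < 1 / 2 then x / 2 else if x < 3 / 4 then x - 1 / 4 else 2 * x - 1.
Definition b_fun x : R :=
  if x < 1 / 2 then x else 1 / 2 * a_fun (2 * x - 1) + 1 / 2.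
(* Inverses of a and b, see a_funK to bV_funK below. *)
Definition aV_fun x : R :=
  if x < 1 / 4 then 2 * x else if x < 1 / 2 then x + 1 / 4 else (x + 1) / 2.
Definition bV_fun x : R :=
  if x < 1 / 2 then x else 1 / 2 * aV_fun (2 * x - 1) + 1 / 2.

Ltac pl :=
  rewrite /b_fun /bV_fun /a_fun /aV_fun ?in_itv /= => *;
  repeat match goal with
  | H : is_true (_ && _) |- _ => case/andP: H => ? ?
  | |- context [if (?u < ?v)%R then _ else _] =>
      lazymatch u with context [if _ then _ else _] => fail | _ => idtac end;
      case: (ltP u v) => ? /=
  | |- is_true (_ && _) => apply/andP; split
  end; lra.

Lemma a_fun_itv x : x \in `[0, 1] -> a_fun x \in `[0, 1]. Proof. by pl. Qed.
Lemma b_fun_itv x : x \in `[0, 1] -> b_fun x \in `[0, 1]. Proof. by pl. Qed.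
Lemma aV_fun_itv x : x \in `[0, 1] -> aV_fun x \in `[0, 1]. Proof. by pl. Qed.
Lemma bV_fun_itv x : x \in `[0, 1] -> bV_fun x \in `[0, 1]. Proof. by pl. Qed.

Definition gen_a y : unit_interval := exist _ (a_fun (sval y)) (a_fun_itv (svalP y)).
Definition gen_b y : unit_interval := exist _ (b_fun (sval y)) (b_fun_itv (svalP y)).
Definition gen_aV y : unit_interval :=
  exist _ (aV_fun (sval y)) (aV_fun_itv (svalP y)).
Definition gen_bV y : unit_interval :=
  exist _ (bV_fun (sval y)) (bV_fun_itv (svalP y)).

Lemma a_funK : cancel a_fun aV_fun. Proof. by move=> x; pl. Qed.
Lemma aV_funK : cancel aV_fun a_fun. Proof. by move=> x; pl. Qed.
Lemma b_funK : cancel b_fun bV_fun. Proof. by move=> x; pl. Qed.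
Lemma bV_funK : cancel bV_fun b_fun. Proof. by move=> x; pl. Qed.

Lemma gen_aK : cancel gen_a gen_aV.
Proof. by move=> y; apply: val_inj; exact: a_funK. Qed.
Lemma gen_aVK : cancel gen_aV gen_a.
Proof. by move=> y; apply: val_inj; exact: aV_funK. Qed.
Lemma gen_bK : cancel gen_b gen_bV.
Proof. by move=> y; apply: val_inj; exact: b_funK. Qed.
Lemma gen_bVK : cancel gen_bV gen_b.
Proof. by move=> y; apply: val_inj; exact: bV_funK. Qed.

(* Subgroup generated by a and b in the group of bijections of [0, 1]; it is
   contained in the group of homeomorphisms since a and b are. *)
Inductive thompsonF : (unit_interval -> unit_interval) -> Prop :=
| thompsonF_id : thompsonF id
| thompsonF_a : thompsonF gen_a
| thompsonF_b : thompsonF gen_b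
| thompsonF_comp g h : thompsonF g -> thompsonF h -> thompsonF (g \o h)
| thompsonF_inv g h : thompsonF g -> cancel g h -> cancel h g -> thompsonF h.

Lemma thompsonF_aV : thompsonF gen_aV.
Proof. exact: thompsonF_inv thompsonF_a gen_aK gen_aVK. Qed.
Lemma thompsonF_bV : thompsonF gen_bV.
Proof. exact: thompsonF_inv thompsonF_b gen_bK gen_bVK. Qed.

Lemma half_itv : (1 / 2 : R) \in `[0, 1].
Proof. by rewrite in_itv /=; apply/andP; split; lra. Qed.
Definition one_half : unit_interval := exist _ (1 / 2) half_itv.

Definition orbit_half : set unit_interval := [set g one_half | g in thompsonF].

Lemma orbit_half_act g y : thompsonF g -> y \in orbit_half -> g y \in orbit_half.
Proof.
move=> Fg /set_mem[h Fh <-]; apply/mem_set.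
by exists (g \o h) => //; exact: thompsonF_comp.
Qed.

Definition orbit_act g (Fg : thompsonF g) (y : orbit_half) : orbit_half :=
  exist _ (g (sval y)) (orbit_half_act Fg (svalP y)).

Lemma half_in_orbit : one_half \in orbit_half.
Proof. by apply/mem_set; exists id => //; exact: thompsonF_id. Qed.
Definition base_point : orbit_half := exist _ one_half half_in_orbit.

Definition markov_op (f : orbit_half -> R[i]) (y : orbit_half) : R[i] :=
  1 / 4 * (f (orbit_act thompsonF_a y) + f (orbit_act thompsonF_aV y)
           + f (orbit_act thompsonF_b y) + f (orbit_act thompsonF_bV y)).

Definition laplace (f : orbit_half -> R[i]) : orbit_half -> R[i] := f - markov_op f.

Definition delta_half (y : orbit_half) : R[i] := (y == base_point)%:R.

End ThompsonGroup.

Arguments one_half R : clear implicits.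
Arguments orbit_half R : clear implicits.
Arguments base_point R : clear implicits.
Arguments laplace R f : clear implicits.
Arguments delta_half R y : clear implicits.

Section HilbertSpace.
Variables (R : realType) (X : choiceType).
Implicit Types (f g : X -> R[i]).

Definition l2 f : Prop := summable [set: X] (fun x => (Normc.normc (f x) ^+ 2)%:E).

(* Only meaningful on absolutely summable families, which is the case for the
   products of two square-summable functions used below. *)
Definition rsum (u : X -> R) : R :=
  fine (\esum_(x in [set: X]) (EFin \o u)^\+ x
        - \esum_(x in [set: X]) (EFin \o u)^\- x)%E.

(* Linear in the first argument. *)
Definition inner f g : R[i] :=
  (rsum (fun x => complex.Re (f x * (g x)^*)%C)
   +i* rsum (fun x => complex.Im (f x * (g x)^*)%C))%C.

Definition l2norm f : R := Num.sqrt (complex.Re (inner f f)).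

(* Operators on l^2(X) are maps on all functions X -> R[i] of which only the
   values on square-summable functions are relevant. *)
Record orthogonal_projection (P : (X -> R[i]) -> (X -> R[i])) : Prop := {
  proj_l2 : forall f, l2 f -> l2 (P f) ;
  proj_linear : forall (c : R[i]) f g, l2 f -> l2 g ->
    P (c *: f + g) = c *: P f + P g ;
  proj_idem : forall f, l2 f -> P (P f) = P f ;
  proj_selfadjoint : forall f g, l2 f -> l2 g -> inner (P f) g = inner f (P g) }.

(* (E B xi, xi) is real for an orthogonal projection E B. *)
Definition spectral_measure
  (E : set (measurableTypeR R) -> (X -> R[i]) -> (X -> R[i]))
  (xi : X -> R[i]) (B : set (measurableTypeR R)) : R := complex.Re (inner (E B xi) xi).

(* E is the projection-valued spectral measure of the bounded self-adjoint
   operator T: a compactly supported projection-valued Borel measure on R,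
   countably additive in the strong operator topology, such that T is the
   integral of the identity with respect to E in the weak sense,
   (T f, f) = \int x d(E(x) f, f) for all f, which by polarization gives
   (T f, g) for all f and g. *)
Record spectral_resolution (T : (X -> R[i]) -> (X -> R[i]))
    (E : set (measurableTypeR R) -> (X -> R[i]) -> (X -> R[i])) : Prop := {
  pvm_proj : forall B, measurable B -> orthogonal_projection (E B) ;
  pvm_setT : forall f, l2 f -> E setT f = f ;
  pvm_setI : forall A B f, measurable A -> measurable B -> l2 f ->
    E (A `&` B) f = E A (E B f) ;
  pvm_sigma_additive : forall (B : nat -> set (measurableTypeR R)) f,
    (forall n, measurable (B n)) -> trivIset setT B -> l2 f ->
    (fun n => l2norm (E (\bigcup_k B k) f - \sum_(k < n) E (B k) f))
      @ \oo --> (0 : R) ;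
  pvm_bounded : exists r : R, forall f, l2 f -> E [set` `[- r, r]] f = f ;
  pvm_integral : forall f, l2 f ->
    inner (T f) f =
      (fine (\int[EFin \o spectral_measure E f]_(x in setT) x%:E))%:C%C }.

End HilbertSpace.

(* Main.v *)
(* Savchuk's description of the Schreier graph makes it a tree built from copies
   of two rays, so the resolvent vector u of the Laplace operator at
   z = t + i e is explicit: it is multiplied by a constant p, q, v or w along
   each edge leading away from the root, according to the type of the edge.
   With z = - s^2 the constants p, q of the rays are analytic in s, and v, w are
   obtained from a cubic equation. Hence G = u(1/2) = g0 + g1 s + O(s^2) with
   real g0 and g1 < 0, so that Im G = - g1 sqrt t + O(|t| + sqrt e).

   On the spectral side, E commutes with T, and T - z acts almost as a scalar on
   the range of E(I) for a short interval I; as (T - z) u = delta, the Poisson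
   sums of the spectral measure over a fine partition approximate Im G.
   Integrating these in t gives arctangents, which differ little from pi times
   the indicator function of [- s, s], and the choice e = s^4 yields
   pi N(s) = (2/3) (- g1) s^(3/2) + O(s^2). *)

Require Import Defs.
From HB Require Import structures.
From mathcomp Require Import all_boot all_order all_algebra.
From mathcomp Require Import all_classical all_reals all_analysis.
From mathcomp Require Import ring lra.

Set Implicit Arguments.
Unset Strict Implicit.
Unset Printing Implicit Defensive.
Import Order.TTheory GRing.Theory Num.Theory.
Import numFieldNormedType.Exports.

Local Open Scope classical_set_scope.
Local Open Scope ring_scope.

(** * Real inner product on square-summable functions *)

(** A [spectral_resolution] gives [T] only through its quadratic form, so commutation with [E] has
    to be extracted from that form: two vectors with disjoint spectral supports have additive
    spectral measures, which forces [(T f, g) = 0]. The almost scalar action on a short interval is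
    Cauchy-Schwarz for a form lying between 0 and h. Finite Poisson sums then do the work of the
    Stieltjes transform. The exponent comes from the rays. At z = 0 the multipliers p and q reach 1,
    with p = 1 - 2 s + O(s^2), while v = 2 - sqrt 2 and w = 1 / sqrt 2 keep the branching part
    square-summable. The rays thus bring sqrt (- z) into G at first order, that is, a spectral
    density of order sqrt t. For e = s^4, with s now the argument of N: moving the end of the window
    by s^2 changes s^(3/2) only by O(s^(5/2)), and an arctangent of width s^4 seen from distance s^2
    is within s^2 of its limit. *)

Section RealSums.
Variables (R : realType) (X : choiceType).
Implicit Types (u v p q : X -> R).

Definition rsummable u := summable [set: X] (EFin \o u).

Lemma rsummable_le u v : (forall x, `|u x| <= v x) -> rsummable v -> rsummable u.
Proof.
move=> uv; apply: le_lt_trans; apply: le_esum => x _ /=.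
by rewrite lee_fin (le_trans (uv x))// ler_norm.
Qed.

Lemma rsummableD u v : rsummable u -> rsummable v ->
  rsummable (fun x => u x + v x).
Proof. exact: summableD. Qed.

Lemma rsummable_fin_num u : (forall x, 0 <= u x) -> rsummable u ->
  \esum_(x in [set: X]) (u x)%:E \is a fin_num.
Proof.
move=> u0; rewrite /rsummable summableE; congr (_ \is a fin_num).
by apply: eq_esum => x _ /=; rewrite ger0_norm.
Qed.

Lemma esum_scale_le (c : R) u : 0 < c -> (forall x, 0 <= u x) ->
  (\esum_(x in [set: X]) (c * u x)%:E <=
   c%:E * \esum_(x in [set: X]) (u x)%:E)%E.
Proof.
move=> c0 u0; apply: ge_ereal_sup => _ [F [finF FS] <-].
have -> : (\sum_(x \in F) (c * u x)%:E = c%:E * \sum_(x \in F) (u x)%:E)%E.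
  rewrite !fsbig_finite //= ge0_sume_distrr//.
  by move=> i _; rewrite lee_fin.
apply: lee_wpmul2l; first by rewrite lee_fin ltW.
by apply: ereal_sup_ubound; exists F.
Qed.

(** The converse inequality is [esum_scale_le] for [c^-1] and the family [c * u]. *)
Lemma esum_scale (c : R) u : 0 < c -> (forall x, 0 <= u x) ->
  (\esum_(x in [set: X]) (c * u x)%:E =
   c%:E * \esum_(x in [set: X]) (u x)%:E)%E.
Proof.
move=> c0 u0; apply/eqP; rewrite eq_le esum_scale_le//=.
have cu0 x : 0 <= c * u x by rewrite mulr_ge0// ltW.
have c'0 : 0 < c^-1 by rewrite invr_gt0.
have := esum_scale_le c'0 cu0.
rewrite (_ : (fun x => _) = (fun x => (u x)%:E)); last first.
  by apply/funext => x; rewrite mulKf// gt_eqF.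
move/(lee_wpmul2l (ltW c0 : (0 <= c%:E)%E))/le_trans; apply.
by rewrite muleA -EFinM divff ?gt_eqF// mul1e.
Qed.

Lemma rsummableZ (c : R) u : rsummable u -> rsummable (fun x => c * u x).
Proof.
move=> su; have su' : rsummable (fun x => `|u x|).
  by move: su; apply: le_lt_trans; apply: le_esum => x _ /=; rewrite normr_id.
apply: (@rsummable_le _ (fun x => (`|c| + 1) * `|u x|)) => [x|].
  by rewrite normrM ler_wpM2r// lerDl.
have u0 x : 0 <= `|u x| by [].
have c0 : 0 < `|c| + 1 by rewrite ltr_wpDl.
have := rsummable_fin_num u0 su'.
rewrite /rsummable /summable => fn.
under eq_esum do rewrite /= ger0_norm ?mulr_ge0 ?(ltW c0)//.
by rewrite esum_scale// ltey_eq fin_numM.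
Qed.

(** Any splitting into nonnegative summable families computes [rsum], not only the positive and
    negative parts of its definition. Linearity rests on this, since the parts of a sum are not the
    sums of the parts. *)
Lemma rsumB_ge0 p q : (forall x, 0 <= p x) -> (forall x, 0 <= q x) ->
  rsummable p -> rsummable q ->
  rsum (fun x => p x - q x) =
  fine (\esum_(x in [set: X]) (p x)%:E) - fine (\esum_(x in [set: X]) (q x)%:E).
Proof.
move=> p0 q0 sp sq; rewrite /rsum -fineB ?rsummable_fin_num//.
by congr fine; apply: (esumB sp sq) => x _; rewrite lee_fin.
Qed.

Lemma rsum_ge0E u : (forall x, 0 <= u x) -> rsummable u ->
  rsum u = fine (\esum_(x in [set: X]) (u x)%:E).
Proof.
move=> u0 su.
have s0 : rsummable (fun=> 0).
  by rewrite /rsummable /summable esum1// => i _ /=; rewrite normr0.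
have := rsumB_ge0 u0 (fun=> lexx 0) su s0.
rewrite [X in _ - fine X]esum1// subr0 => <-.
by congr rsum; apply/funext => x; rewrite subr0.
Qed.

Let pos u x := Num.max (u x) 0.
Let neg u x := Num.max (- u x) 0.

Let posnegE u : u = (fun x => pos u x - neg u x).
Proof.
apply/funext => x; rewrite /pos /neg.
by case: (leP (u x) 0) => h; case: (leP (- u x) 0) => k; lra.
Qed.
Let pos_ge0 u x : 0 <= pos u x. Proof. by rewrite le_max lexx orbT. Qed.
Let neg_ge0 u x : 0 <= neg u x. Proof. by rewrite le_max lexx orbT. Qed.
Let spos u : rsummable u -> rsummable (pos u).
Proof.
move=> su; apply: (@rsummable_le _ (fun x => `|u x|)) => [x|].
  rewrite ger0_norm ?pos_ge0// /pos ge_max ler_norm normr_ge0 //.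
by move: su; apply: le_lt_trans; apply: le_esum => x _ /=; rewrite normr_id.
Qed.
Let sneg u : rsummable u -> rsummable (neg u).
Proof.
move=> su; apply: (@rsummable_le _ (fun x => `|u x|)) => [x|].
  by rewrite ger0_norm ?neg_ge0// /neg ge_max normr_ge0 -normrN ler_norm.
by move: su; apply: le_lt_trans; apply: le_esum => x _ /=; rewrite normr_id.
Qed.

Lemma rsumD u v : rsummable u -> rsummable v ->
  rsum (fun x => u x + v x) = rsum u + rsum v.
Proof.
move=> su sv; rewrite [in RHS](posnegE u) [in RHS](posnegE v).
rewrite !rsumB_ge0//; try by [exact: spos|exact: sneg].
rewrite (_ : (fun x => _) = (fun x => (pos u x + pos v x) - (neg u x + neg v x)));
  last by apply/funext => x; rewrite {1}(posnegE u) {1}(posnegE v)/=; ring.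
rewrite rsumB_ge0//; first last.
- by apply: rsummableD; exact: sneg.
- by apply: rsummableD; exact: spos.
- by move=> x; rewrite addr_ge0.
- by move=> x; rewrite addr_ge0.
have E p q : (forall x, 0 <= p x) -> (forall x, 0 <= q x) ->
  rsummable p -> rsummable q -> fine (\esum_(x in [set: X]) (p x + q x)%:E) =
  fine (\esum_(x in [set: X]) (p x)%:E) + fine (\esum_(x in [set: X]) (q x)%:E).
  move=> p0 q0 sp sq; rewrite -fineD ?rsummable_fin_num//.
  by congr fine; rewrite -esumD// => x _; rewrite lee_fin.
rewrite (E (pos u) (pos v)) ?(E (neg u) (neg v))//;
  try by [exact: spos|exact: sneg].
by ring.
Qed.

Lemma rsumN u : rsummable u -> rsum (fun x => - u x) = - rsum u.
Proof.
move=> su; rewrite [in RHS](posnegE u).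
rewrite (_ : (fun x => _) = (fun x => neg u x - pos u x)); last first.
  by apply/funext => x; rewrite {1}(posnegE u) opprB.
by rewrite !rsumB_ge0 ?opprB//; by [exact: spos|exact: sneg].
Qed.

Lemma rsumZ (c : R) u : rsummable u -> rsum (fun x => c * u x) = c * rsum u.
Proof.
move=> su.
have P a : 0 < a -> rsum (fun x => a * u x) = a * rsum u.
  move=> a0; rewrite [in RHS](posnegE u).
  rewrite (_ : (fun x => _) = (fun x => a * pos u x - a * neg u x)); last first.
    by apply/funext => x; rewrite {1}(posnegE u) mulrBr.
  have a'0 := ltW a0.
  rewrite rsumB_ge0; first last.
  - by apply: rsummableZ; exact: sneg.
  - by apply: rsummableZ; exact: spos.
  - by move=> x; rewrite mulr_ge0.
  - by move=> x; rewrite mulr_ge0.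
  rewrite !esum_scale// !fineM ?rsummable_fin_num//; try by [exact: spos|exact: sneg].
  by rewrite rsumB_ge0 ?mulrBr//; by [exact: spos|exact: sneg].
have [c0|c0|->] := ltrgtP c 0.
- rewrite (_ : (fun x => _) = (fun x => - (- c * u x))); last first.
    by apply/funext => x; rewrite mulNr opprK.
  by rewrite rsumN ?P ?oppr_gt0 ?mulNr ?opprK//; exact: rsummableZ.
- exact: P.
- rewrite mul0r rsum_ge0E ?esum1//.
  + by move=> x _; rewrite mul0r.
  + by move=> x; rewrite mul0r.
  + exact: rsummableZ.
Qed.

Lemma rsum_ge0 u : (forall x, 0 <= u x) -> rsummable u -> 0 <= rsum u.
Proof.
move=> u0 su; rewrite rsum_ge0E// fine_ge0// esum_ge0// => x _.
by rewrite lee_fin.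
Qed.

Lemma rsum_ge1 u x : (forall x, 0 <= u x) -> rsummable u -> u x <= rsum u.
Proof.
move=> u0 su; rewrite rsum_ge0E// -lee_fin fineK ?rsummable_fin_num//.
apply: esum_ge; exists [set x]; first by split => //; exact: finite_set1.
by rewrite fsbig_set1.
Qed.

Lemma rsum_point u x0 : (forall x, x != x0 -> u x = 0) ->
  rsummable u /\ rsum u = u x0.
Proof.
have ge0P v : (forall x, 0 <= v x) -> (forall x, x != x0 -> v x = 0) ->
    \esum_(x in [set: X]) (v x)%:E = (v x0)%:E.
  move=> v0 vx; transitivity (\esum_(x in [set x0]) (v x)%:E);
    last by rewrite esum_set1 ?lee_fin.
  rewrite [RHS]esum_mkcond; apply: eq_esum => x _; rewrite in_set1.
  by case: eqVneq => [->//|/vx ->].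
move=> ux.
have su : rsummable u.
  rewrite /rsummable /summable/= ge0P ?ltry//= => x /ux ->.
  by rewrite normr0.
split => //; rewrite [LHS](_ : _ = rsum (fun x => pos u x - neg u x)); last first.
  by rewrite -posnegE.
rewrite rsumB_ge0 ?ge0P//=; try by [exact: spos|exact: sneg].
- by rewrite [RHS](f_equal (fun f => f x0) (posnegE u)).
- by move=> x /ux; rewrite /neg => ->; rewrite oppr0 maxxx.
- by move=> x /ux; rewrite /pos => ->; rewrite maxxx.
Qed.

Lemma rsummable_bij (e : X -> X) u : bijective e ->
  rsummable (u \o e) <-> rsummable u.
Proof.
move=> be; have Be : set_bij [set: X] [set: X] e by rewrite setTT_bijective.
by rewrite /rsummable /summable 
  (@reindex_esum R X X _ _ e (fun x => `|(u x)%:E|%E) Be).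
Qed.

Lemma rsum_bij (e : X -> X) u : bijective e -> rsum (u \o e) = rsum u.
Proof.
move=> be; have Be : set_bij [set: X] [set: X] e by rewrite setTT_bijective.
have EP := @reindex_esum R X X _ _ e (fun x => (EFin \o u)^\+ x)%E Be.
have EN := @reindex_esum R X X _ _ e (fun x => (EFin \o u)^\- x)%E Be.
rewrite /rsum EP EN; congr (fine (_ - _)%E); apply: eq_esum => x _.
  by rewrite !funeposE.
by rewrite !funenegE.
Qed.

End RealSums.

Section RealInner.
Variables (R : realType) (X : choiceType).
Implicit Types (f g h : X -> R[i]).

(** Real part of z times the conjugate of w. The real inner product built on it loses nothing:
    imaginary parts are recovered by pairing with a multiple of i, as in [rinner_i_delta]. *)
Definition redot (z w : R[i]) : R :=
  complex.Re z * complex.Re w + complex.Im z * complex.Im w.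

Definition rinner f g : R := rsum (fun x => redot (f x) (g x)).

Lemma Re_inner f g : complex.Re (inner f g) = rinner f g.
Proof.
rewrite /inner /rinner /=; congr rsum; apply/funext => x.
by rewrite /redot; case: (f x) => a b; case: (g x) => c d /=; ring.
Qed.

Lemma redotC z w : redot z w = redot w z.
Proof. by rewrite /redot; ring. Qed.

Lemma redotDl z z' w : redot (z + z') w = redot z w + redot z' w.
Proof. by rewrite /redot; case: z z' w => [a b] [c d] [e f] /=; ring. Qed.

Lemma redot_normc z : redot z z = Normc.normc z ^+ 2.
Proof.
case: z => a b; rewrite /redot /= sqr_sqrtr ?addr_ge0 ?sqr_ge0//; ring.
Qed.

Lemma redot_ge0 z : 0 <= redot z z.
Proof. by rewrite redot_normc sqr_ge0. Qed.

Lemma l2E f : l2 f <-> rsummable (fun x => redot (f x) (f x)).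
Proof.
rewrite /l2 (_ : (fun _ => _) = EFin \o (fun x => redot (f x) (f x)))//.
by apply/funext => x /=; rewrite redot_normc.
Qed.

Lemma redot_le z w : `|redot z w| <= redot z z + redot w w.
Proof.
rewrite /redot; case: z w => [a b] [c d] /=.
have h1 := sqr_ge0 (a + c); have h2 := sqr_ge0 (a - c).
have h3 := sqr_ge0 (b + d); have h4 := sqr_ge0 (b - d).
have h5 := sqr_ge0 a; have h6 := sqr_ge0 b.
have h7 := sqr_ge0 c; have h8 := sqr_ge0 d.
by rewrite ler_norml; apply/andP; split; nra.
Qed.

Lemma rsummable_redot f g : l2 f -> l2 g ->
  rsummable (fun x => redot (f x) (g x)).
Proof.
move=> /l2E lf /l2E lg; apply: rsummable_le (rsummableD lf lg) => x.
exact: redot_le.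
Qed.

Lemma l2D f g : l2 f -> l2 g -> l2 (f + g).
Proof.
move=> lf lg; have /l2E lf' := lf; have /l2E lg' := lg; apply/l2E.
have := rsummableZ 2 (rsummableD lf' lg'); apply: rsummable_le => x.
rewrite ger0_norm ?redot_ge0//; rewrite /redot !fctE.
case: (f x) (g x) => [a b] [c d] /=.
have h1 := sqr_ge0 (a - c); have h2 := sqr_ge0 (b - d); nra.
Qed.

Lemma redotZ (c z : R[i]) :
  redot (c * z) (c * z) = redot c c * redot z z.
Proof. by rewrite /redot; case: c z => [a b] [d e] /=; ring. Qed.

Lemma l2Z (c : R[i]) f : l2 f -> l2 (c *: f).
Proof.
move=> /l2E lf; apply/l2E; apply: rsummable_le (rsummableZ (redot c c) lf) => x.
by rewrite ger0_norm ?redot_ge0// -redotZ.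
Qed.

Lemma l2N f : l2 f -> l2 (- f).
Proof. by move=> lf; rewrite -scaleN1r; exact: l2Z. Qed.

Lemma l2B f g : l2 f -> l2 g -> l2 (f - g).
Proof. by move=> lf lg; apply: l2D => //; exact: l2N. Qed.

Lemma l20 : l2 (0 : X -> R[i]).
Proof.
apply/l2E; apply: (@rsummable_le _ _ _ (fun=> 0)) => [x|].
  by rewrite /redot /= !mulr0 addr0 normr0.
by rewrite /rsummable /summable esum1// => i _ /=; rewrite normr0.
Qed.

Lemma l2_sum (I : Type) (r : seq I) (P : pred I) (F : I -> X -> R[i]) :
  (forall i, l2 (F i)) -> l2 (\sum_(i <- r | P i) F i).
Proof. by move=> lF; apply: big_ind => //; [exact: l20|exact: l2D]. Qed.

Lemma rinnerC f g : rinner f g = rinner g f.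
Proof. by congr rsum; apply/funext => x; rewrite redotC. Qed.

Lemma rinnerDl f g h : l2 f -> l2 g -> l2 h ->
  rinner (f + g) h = rinner f h + rinner g h.
Proof.
move=> lf lg lh; rewrite /rinner -rsumD; try exact: rsummable_redot.
by congr rsum; apply/funext => x; rewrite fctE redotDl.
Qed.

Lemma rinnerDr f g h : l2 f -> l2 g -> l2 h ->
  rinner h (f + g) = rinner h f + rinner h g.
Proof. by move=> *; rewrite !(rinnerC h) rinnerDl. Qed.

Lemma rinnerZl (a : R) f g : l2 f -> l2 g ->
  rinner (a%:C%C *: f) g = a * rinner f g.
Proof.
move=> lf lg; rewrite /rinner -rsumZ; last exact: rsummable_redot.
congr rsum; apply/funext => x; rewrite /redot /=.
have -> : (a%:C%C *: f) x = a%:C%C * f x by [].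
by case: (f x) (g x) => [b c] [d e] /=; ring.
Qed.

Lemma rinnerZr (a : R) f g : l2 f -> l2 g ->
  rinner g (a%:C%C *: f) = a * rinner g f.
Proof. by move=> *; rewrite !(rinnerC g) rinnerZl. Qed.

Lemma rinnerNl f g : l2 f -> l2 g -> rinner (- f) g = - rinner f g.
Proof.
move=> lf lg; rewrite -[RHS]mulN1r -rinnerZl//.
by rewrite (_ : (-1)%:C%C = -1) ?scaleN1r// raddfN.
Qed.

Lemma rinnerNr f g : l2 f -> l2 g -> rinner g (- f) = - rinner g f.
Proof. by move=> *; rewrite !(rinnerC g) rinnerNl. Qed.

Lemma rinnerBl f g h : l2 f -> l2 g -> l2 h ->
  rinner (f - g) h = rinner f h - rinner g h.
Proof. by move=> lf lg lh; rewrite rinnerDl ?rinnerNl//; exact: l2N. Qed.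

Lemma rinnerBr f g h : l2 f -> l2 g -> l2 h ->
  rinner h (f - g) = rinner h f - rinner h g.
Proof. by move=> *; rewrite !(rinnerC h) rinnerBl. Qed.

(** Multiplication by i is skew for the real inner product. Hence [u] is orthogonal to i times a
    symmetric operator applied to [u], which is how [Im_resolvent] discards real contributions. *)
Lemma rinner_iC f g : l2 f -> l2 g ->
  rinner ('i%C *: f) g = - rinner ('i%C *: g) f.
Proof.
move=> lf lg; rewrite /rinner -rsumN; last first.
  by apply: rsummable_redot => //; exact: l2Z.
congr rsum; apply/funext => x; rewrite /redot.
have iE h : ('i%C *: h) x = 'i%C * h x by [].
by rewrite !iE; case: (f x) (g x) => [a b] [c d] /=; ring.
Qed.

Lemma rinner_ge0 f : l2 f -> 0 <= rinner f f.
Proof.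
move=> lf; apply: rsum_ge0; last exact: rsummable_redot.
by move=> x; exact: redot_ge0.
Qed.

Lemma rinner_eq0 f : l2 f -> rinner f f = 0 -> f = 0.
Proof.
move=> lf f0; apply/funext => x.
have ge0 y : 0 <= redot (f y) (f y) by exact: redot_ge0.
have := @rsum_ge1 _ _ _ x ge0 (rsummable_redot lf lf).
rewrite -/(rinner f f) f0 => le0.
have := redot_ge0 (f x); rewrite redot_normc => _.
move: le0; rewrite redot_normc => le0.
have /eqP : Normc.normc (f x) ^+ 2 = 0 by apply/eqP; rewrite eq_le le0 sqr_ge0.
by rewrite sqrf_eq0 => /eqP /Normc.eq0_normc.
Qed.

Lemma rinner_normcZ (c : R[i]) f : l2 f ->
  rinner (c *: f) (c *: f) = Normc.normc c ^+ 2 * rinner f f.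
Proof.
move=> lf; rewrite -redot_normc /rinner -rsumZ; last exact: rsummable_redot.
by congr rsum; apply/funext => x; rewrite -redotZ.
Qed.

End RealInner.

Lemma quadratic_discr (R : realFieldType) (a b c : R) : 0 <= c ->
  (forall t, 0 <= a + 2 * b * t + c * t ^+ 2) -> b ^+ 2 <= a * c.
Proof.
rewrite le_eqVlt => /orP[/eqP <-|c0] h.
  have [->|b0] := eqVneq b 0; first by rewrite expr0n mulr0.
  (* For [c = 0] and [b != 0] the affine function takes the value -1 at this point. *)
  have := h (- (a + 1) / (2 * b)).
  rewrite mul0r addr0 mulrCA divff ?mulf_neq0// mulr1; lra.
have := h (- b / c).
rewrite (_ : a + _ + _ = (a * c - b ^+ 2) / c); last by field; rewrite gt_eqF.
by rewrite pmulr_lge0 ?invr_gt0// subr_ge0.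
Qed.

Section RealNorm.
Variables (R : realType) (X : choiceType).
Implicit Types (f g h : X -> R[i]).

Definition rnorm f : R := Num.sqrt (rinner f f).

Lemma rnorm_ge0 f : 0 <= rnorm f. Proof. exact: sqrtr_ge0. Qed.

Lemma rnorm_sqr f : l2 f -> rnorm f ^+ 2 = rinner f f.
Proof. by move=> lf; rewrite sqr_sqrtr// rinner_ge0. Qed.

Lemma rinner_sqrD f g : l2 f -> l2 g ->
  rinner (f + g) (f + g) = rinner f f + 2 * rinner f g + rinner g g.
Proof.
move=> lf lg; have lfg := l2D lf lg.
by rewrite rinnerDl// !rinnerDr// (rinnerC g f); ring.
Qed.

Lemma rinner_CS f g : l2 f -> l2 g -> rinner f g <= rnorm f * rnorm g.
Proof.
move=> lf lg; have lt t := l2Z t%:C%C lg.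
have : rinner f g ^+ 2 <= rinner f f * rinner g g.
  apply: quadratic_discr; first exact: rinner_ge0.
  move=> t; have := rinner_ge0 (l2D lf (lt t)).
  rewrite rinner_sqrD// rinnerZr// rinnerZr// rinnerZl//.
  by congr (0 <= _); ring.
rewrite -!rnorm_sqr// -exprMn => h.
rewrite (le_trans (ler_norm _))// -(ler_pXn2r (n := 2))//.
by rewrite real_normK// num_real.
by rewrite nnegrE mulr_ge0 ?rnorm_ge0.
Qed.

Lemma rinner_CS_abs f g : l2 f -> l2 g -> `|rinner f g| <= rnorm f * rnorm g.
Proof.
move=> lf lg; rewrite ler_norml rinner_CS// andbT lerNl -rinnerNl//.
have -> : rnorm f = rnorm (- f).
  by rewrite /rnorm rinnerNl ?rinnerNr ?opprK//; exact: l2N.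
by apply: rinner_CS => //; exact: l2N.
Qed.

Lemma rnorm_triangle f g : l2 f -> l2 g -> rnorm (f + g) <= rnorm f + rnorm g.
Proof.
move=> lf lg; rewrite -(ler_pXn2r (n := 2)) ?nnegrE ?addr_ge0 ?rnorm_ge0//.
rewrite rnorm_sqr ?rinner_sqrD//; last exact: l2D.
rewrite -!rnorm_sqr// sqrrD; have := rinner_CS lf lg; lra.
Qed.

Lemma rnormZ (c : R[i]) f : l2 f -> rnorm (c *: f) = Normc.normc c * rnorm f.
Proof.
move=> lf; have c0 : 0 <= Normc.normc c by case: c => a b; exact: sqrtr_ge0.
by rewrite /rnorm rinner_normcZ// sqrtrM ?sqr_ge0// sqrtr_sqr ger0_norm.
Qed.

Lemma rnorm_le0 f : l2 f -> rnorm f <= 0 -> f = 0.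
Proof.
move=> lf f0; apply: rinner_eq0 => //; rewrite -rnorm_sqr//.
have -> : rnorm f = 0 by apply/eqP; rewrite eq_le f0 rnorm_ge0.
by rewrite expr0n.
Qed.

Lemma rinner0l f : l2 f -> rinner 0 f = 0.
Proof.
by move=> lf; have := rinnerZl 0 lf lf; rewrite mul0r (_ : 0%:C%C = 0)// scale0r.
Qed.

Lemma rinner_suml (I : Type) (r : seq I) (F : I -> X -> R[i]) g :
  (forall i, l2 (F i)) -> l2 g ->
  rinner (\sum_(i <- r) F i) g = \sum_(i <- r) rinner (F i) g.
Proof.
move=> lF lg; elim: r => [|i r IH]; first by rewrite !big_nil rinner0l.
by rewrite !big_cons rinnerDl ?IH//; exact: l2_sum.
Qed.

Lemma normc_real (a : R) : Normc.normc a%:C%C = `|a|.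
Proof. by rewrite /= expr0n addr0 sqrtr_sqr. Qed.

End RealNorm.

(** * Spectral resolutions *)

Section IntegralMeasurableSets.
Context d (T : measurableType d) (R : realType).
Import HBNNSimple.

(** The integral in [pvm_integral] is against a bare set function, arbitrary off the measurable
    sets. Only its values on level sets of simple functions enter, so a genuine measure can be put
    in its place. *)
Lemma integral_eq_measurable (m1 m2 : set T -> \bar R) (f : T -> \bar R) :
  (forall A, measurable A -> m1 A = m2 A) ->
  (\int[m1]_(x in setT) f x = \int[m2]_(x in setT) f x)%E.
Proof.
move=> m12.
have sub (u v : set T -> \bar R) (g : T -> \bar R) :
    (forall A, measurable A -> u A = v A) ->
    [set sintegral u h | h in
      [set h : {nnsfun T >-> R} | forall x, ((h x)%:E <= g x)%E]] `<=`
    [set sintegral v h | h in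
      [set h : {nnsfun T >-> R} | forall x, ((h x)%:E <= g x)%E]].
  move=> uv _ [h hg <-]; exists h => //; apply: eq_fsbigr => r _.
  by rewrite uv.
rewrite /integral; congr (ereal_sup _ - ereal_sup _)%E; apply/seteqP; split;
  by apply: sub => A mA; rewrite m12.
Qed.

End IntegralMeasurableSets.

Section SpectralResolution.
Variables (R : realType) (X : choiceType).
Variables (T : (X -> R[i]) -> (X -> R[i])).
Variables (E : set (measurableTypeR R) -> (X -> R[i]) -> (X -> R[i])).
Hypothesis hE : spectral_resolution T E.
Implicit Types (f g h : X -> R[i]) (A B : set (measurableTypeR R)).

Lemma E_l2 B f : measurable B -> l2 f -> l2 (E B f).
Proof. by move=> mB; exact: proj_l2 (pvm_proj hE mB) f. Qed.

Lemma E_add B f g : measurable B -> l2 f -> l2 g -> E B (f + g) = E B f + E B g.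
Proof.
move=> mB lf lg; have := proj_linear (pvm_proj hE mB) 1 lf lg.
by rewrite !scale1r.
Qed.

Lemma E_0 B : measurable B -> E B 0 = 0.
Proof.
move=> mB; have := proj_linear (pvm_proj hE mB) (-1) (l20 R X) (l20 R X).
by rewrite scaler0 addr0 scaleN1r addNr.
Qed.

Lemma E_scale B (c : R[i]) f : measurable B -> l2 f -> E B (c *: f) = c *: E B f.
Proof.
move=> mB lf; have := proj_linear (pvm_proj hE mB) c lf (l20 R X).
by rewrite E_0// !addr0.
Qed.

Lemma E_sym B f g : measurable B -> l2 f -> l2 g ->
  rinner (E B f) g = rinner f (E B g).
Proof.
by move=> mB lf lg; rewrite -!Re_inner (proj_selfadjoint (pvm_proj hE mB)).
Qed.

Lemma E_idem B f : measurable B -> l2 f -> E B (E B f) = E B f.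
Proof. by move=> mB; exact: proj_idem (pvm_proj hE mB) f. Qed.

Lemma spectral_measureE B f : measurable B -> l2 f ->
  spectral_measure E f B = rinner (E B f) (E B f).
Proof.
move=> mB lf; have lE := E_l2 mB lf.
by rewrite /spectral_measure Re_inner [RHS]E_sym// E_idem// E_sym.
Qed.

Lemma spectral_measure_ge0 B f : measurable B -> l2 f ->
  0 <= spectral_measure E f B.
Proof. by move=> mB lf; rewrite spectral_measureE// rinner_ge0//; exact: E_l2. Qed.

Lemma pvm_sigma_additive_rnorm (B : nat -> set (measurableTypeR R)) f :
  (forall n, measurable (B n)) -> trivIset setT B -> l2 f ->
  rnorm (E (\bigcup_k B k) f - \sum_(k < n) E (B k) f) @[n --> \oo] --> (0 : R).
Proof.
move=> mB tB lf; have := pvm_sigma_additive hE mB tB lf.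
by under eq_fun do rewrite /l2norm Re_inner.
Qed.

(** Additivity on the constant sequence [set0] says that (1 - n) [E set0 f] tends to 0, while its
    norm is at least that of [E set0 f] once n >= 2. *)
Lemma E_set0 f : l2 f -> E set0 f = 0.
Proof.
move=> lf; have lE : l2 (E set0 f) by exact: E_l2.
have := @pvm_sigma_additive_rnorm (fun=> set0) f (fun=> measurable0).
move=> /(_ (@trivIset_set0 _ _ setT) lf); rewrite bigcup0// => cv.
apply: rnorm_le0 => //; apply: (cvgr_to_ge cv); exists 2%N => // n /= n2.
rewrite sumr_const card_ord -scaler_nat -{2}[E set0 f]scale1r -scalerBl.
rewrite rnormZ// -[leLHS]mul1r ler_wpM2r ?rnorm_ge0//.
rewrite (_ : 1 - n%:R = (1 - n%:R)%:C%C); last first.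
  by rewrite rmorphB rmorph1 rmorph_nat.
have n2' : 2 <= n%:R :> R by rewrite ler_nat.
by rewrite normc_real -normrN ger0_norm; lra.
Qed.

Lemma E_setU A B f : measurable A -> measurable B -> A `&` B = set0 -> l2 f ->
  E (A `|` B) f = E A f + E B f.
Proof.
move=> mA mB AB lf.
have mAB k : measurable (bigcup2 A B k) by case: k => [//|[//|k]]; exact: measurable0.
have := pvm_sigma_additive_rnorm mAB; rewrite -trivIset_bigcup2 bigcup2E.
move=> /(_ _ AB lf) cv; apply/subr0_eq.
have lA := E_l2 mA lf; have lB := E_l2 mB lf.
have lU := E_l2 (measurableU _ _ mA mB) lf.
apply: rnorm_le0; first by apply: l2B => //; exact: l2D.
(* From rank 2 on the partial sums no longer change, so the norm that tends to 0 is already 0. *)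
apply: (cvgr_to_ge cv); exists 2%N => // -[//|[//|n]] _ /=.
rewrite !big_ord_recl big1 ?addr0 ?addrA//= => i _.
by rewrite E_set0.
Qed.

Lemma E_setC B f : measurable B -> l2 f -> f = E B f + E (~` B) f.
Proof.
move=> mB lf; rewrite -E_setU//; [|exact: measurableC|exact: setICr].
by rewrite setUv (pvm_setT hE).
Qed.

Lemma E_disjoint A B f : measurable A -> measurable B -> A `&` B = set0 ->
  l2 f -> E A (E B f) = 0.
Proof. by move=> mA mB AB lf; rewrite -(pvm_setI hE)// AB E_set0. Qed.

Lemma E_orthogonal A B f g : measurable A -> measurable B -> A `&` B = set0 ->
  l2 f -> l2 g -> rinner (E A f) (E B g) = 0.
Proof.
move=> mA mB AB lf lg; rewrite E_sym//; last exact: E_l2.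
by rewrite E_disjoint// rinnerC rinner0l.
Qed.

Lemma E_subset A B f : measurable A -> measurable B -> A `<=` B ->
  l2 f -> E A (E B f) = E A f.
Proof. by move=> mA mB /setIidPl AB lf; rewrite -(pvm_setI hE)// AB. Qed.

(** Strong convergence passes to the quadratic form by Cauchy-Schwarz; the divisor [rnorm f + 1]
    stays positive even for f = 0. *)
Lemma spectral_measure_sigma_additive f : l2 f ->
  semi_sigma_additive (EFin \o spectral_measure E f).
Proof.
move=> lf F mF tF mUF.
rewrite (_ : (fun n => _) =
    EFin \o (fun n => \sum_(0 <= i < n) spectral_measure E f (F i))); last first.
  by apply/funext => n /=; rewrite sumEFin.
apply: cvg_EFin; first by near=> n.
apply/cvgrPdist_le => e e0.
have f0 : 0 < rnorm f + 1 by rewrite ltr_wpDl ?rnorm_ge0.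
have /cvgr0_norm_le := pvm_sigma_additive_rnorm mF tF lf.
move=> /(_ _ (divr_gt0 e0 f0)).
apply: filterS => n /=; rewrite ger0_norm ?rnorm_ge0// => le_n.
have lF k : l2 (E (F k) f) by exact: E_l2.
have lU : l2 (E (\bigcup_k F k) f) by exact: E_l2.
have lS : l2 (\sum_(k < n) E (F k) f) by exact: l2_sum.
rewrite /spectral_measure big_mkord Re_inner.
under eq_bigr do rewrite Re_inner.
rewrite -rinner_suml// -rinnerBl//.
apply: (le_trans (rinner_CS_abs (l2B lU lS) lf)).
apply: (@le_trans _ _ (e / (rnorm f + 1) * (rnorm f + 1))).
  by apply: ler_pM; rewrite ?rnorm_ge0 ?lerDl.
by rewrite divfK// gt_eqF.
Unshelve. all: by end_near.
Qed.

(* Off the measurable sets, where a resolution of the identity is arbitrary, the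
   measure is set to zero so as to be nonnegative everywhere. *)
Lemma spectral_measure_measure f : l2 f ->
  exists m : {measure set (measurableTypeR R) -> \bar R},
    forall B, measurable B -> m B = (spectral_measure E f B)%:E.
Proof.
move=> lf; pose mu : set (measurableTypeR R) -> \bar R :=
  fun B => if asbool (measurable B) then (spectral_measure E f B)%:E else 0%E.
have muE B : measurable B -> mu B = (spectral_measure E f B)%:E.
  by move=> mB; rewrite /mu asboolT.
have mu0 : mu set0 = 0%E.
  rewrite muE// spectral_measureE//; rewrite E_set0// rinner0l//.
  exact: l20.
have mu_ge0 B : (0 <= mu B)%E.
  rewrite /mu; case: asboolP => // mB.
  by rewrite lee_fin spectral_measure_ge0.
have mu_sa : semi_sigma_additive mu.
  move=> F mF tF mUF; rewrite muE//.
  rewrite (_ : (fun n => _) =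
    (fun n => \sum_(0 <= i < n) (EFin \o spectral_measure E f) (F i))%E).
    exact: spectral_measure_sigma_additive.
  by apply/funext => n; apply: eq_bigr => i _; rewrite muE.
pose mM := isMeasure.Build _ _ _ mu mu0 mu_ge0 mu_sa.
pose m : {measure set (measurableTypeR R) -> \bar R} := HB.pack mu mM.
by exists m.
Qed.

Lemma E_bounded : exists2 r : R, 0 <= r & forall f, l2 f -> E [set` `[- r, r]] f = f.
Proof.
have [r hr] := pvm_bounded hE; exists `|r| => // f lf.
rewrite -[in LHS](hr f lf) -(pvm_setI hE)//.
rewrite (_ : _ `&` _ = [set` `[- r, r]]) ?hr//.
apply/setIidr => x /=; rewrite !in_itv/= => /andP[h1 h2].
have := ler_norm r; rewrite -(normrN r); have := ler_norm (- r).
by move=> h3 h4; apply/andP; split; lra.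
Qed.

Section Measure.
Variables (f : X -> R[i]) (lf : l2 f).
Variable m : {measure set (measurableTypeR R) -> \bar R}.
Hypothesis mE : forall B, measurable B -> m B = (spectral_measure E f B)%:E.

Lemma spectral_mE B : measurable B -> m B = (rinner (E B f) (E B f))%:E.
Proof. by move=> mB; rewrite mE// spectral_measureE. Qed.

Lemma spectral_m0 A B : measurable A -> measurable B -> A `&` B = set0 ->
  E B f = f -> m A = 0%E.
Proof.
move=> mA mB AB fB; rewrite spectral_mE// -fB E_disjoint// rinner0l//.
exact: l20.
Qed.

Lemma spectral_integrable :
  m.-integrable setT (EFin : measurableTypeR R -> \bar R).
Proof.
have [r r0 hr] := E_bounded.
have mI : measurable ([set` `[- r, r]] : set (measurableTypeR R)).
  exact: measurable_itv.
apply/(negligible_integrable (measurableC mI)) => //.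
- by apply: (spectral_m0 (B := [set` `[- r, r]])); rewrite ?setICl ?hr//;
    exact: measurableC.
rewrite setTD setCK -[EFin]/(EFin \o (id : measurableTypeR R -> R)).
apply: measurable_bounded_integrable => //.
- by rewrite spectral_mE// ltry.
- exists r; split; first exact: num_real.
  move=> t rt x /=; rewrite in_itv/= => /andP[h1 h2].
  by rewrite (le_trans _ (ltW rt))// ler_norml h1.
Qed.

Lemma spectral_integral_restrict B : measurable B -> E B f = f ->
  (\int[m]_(x in setT) x%:E = \int[m]_(x in B) x%:E)%E.
Proof.
move=> mB fB; rewrite (negligible_integral (measurableC mB))//.
- by rewrite setTD setCK.
- exact: spectral_integrable.
- by apply: (spectral_m0 (B := B)); rewrite ?setICl//; exact: measurableC.
Qed.

Lemma rinner_integral : rinner (T f) f = fine (\int[m]_(x in setT) x%:E)%E.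
Proof.
rewrite -Re_inner (pvm_integral hE)//=; congr fine.
by apply: integral_eq_measurable => A mA; rewrite mE.
Qed.

(** When [E B f = f], the spectral measure of [f] is carried by [B] and has mass [rinner f f]. *)
Lemma rinner_integral_bounds B (c d : R) : measurable B -> E B f = f ->
  (forall x, B x -> c <= x <= d) ->
  c * rinner f f <= rinner (T f) f <= d * rinner f f.
Proof.
move=> mB fB Bcd; rewrite rinner_integral (spectral_integral_restrict mB fB).
have mBf : m B = (rinner f f)%:E by rewrite spectral_mE// fB.
have iB : m.-integrable B (EFin : measurableTypeR R -> \bar R).
  by apply: integrableS spectral_integrable.
have ic (k : R) : m.-integrable B (EFin \o cst k).
  apply: measurable_bounded_integrable => //; first by rewrite mBf ltry.
  exists `|k|; split; first exact: num_real.
  by move=> t kt x _ /=; exact: ltW.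
have Ec (k : R) : (\int[m]_(x in B) (EFin \o cst k) x = (k * rinner f f)%:E)%E.
  by rewrite EFinM -mBf -integral_cst.
have fin : (\int[m]_(x in B) x%:E)%E \is a fin_num.
  exact: integrable_fin_num.
rewrite -!lee_fin fineK// -!Ec; apply/andP; split; apply: le_integral => //.
- by move=> x /set_mem /Bcd /andP[h1 _]; rewrite lee_fin.
- by move=> x /set_mem /Bcd /andP[_ h1]; rewrite lee_fin.
Qed.

End Measure.

(** * Commutation of [E] with [T], and almost scalar action on short intervals *)

Section Commutation.
Hypothesis T_l2 : forall f, l2 f -> l2 (T f).
Hypothesis T_add : forall f g, T (f + g) = T f + T g.
Hypothesis T_scale : forall (c : R[i]) f, T (c *: f) = c *: T f.
Hypothesis T_sym : forall f g, l2 f -> l2 g -> rinner (T f) g = rinner f (T g).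

(** The spectral measure of [f + g] agrees with that of [f] inside [B] and with that of [g] outside.
    So (T (f + g), f + g) = (T f, f) + (T g, g), and by symmetry of [T] the cross term 2 (T f, g)
    vanishes. *)
Lemma T_orthogonal B f g : measurable B -> l2 f -> l2 g ->
  E B f = f -> E (~` B) g = g -> rinner (T f) g = 0.
Proof.
move=> mB lf lg fB gB; have mCB := measurableC mB.
have lfg := l2D lf lg.
have [m1 m1E] := spectral_measure_measure lf.
have [m2 m2E] := spectral_measure_measure lg.
have [m mE] := spectral_measure_measure lfg.
have EB A : measurable A -> A `<=` B -> E A (f + g) = E A f.
  move=> mA AB; rewrite E_add// -[in E A g]gB E_disjoint ?addr0//.
  by apply/disjoints_subset; rewrite setCK.
have EC A : measurable A -> A `<=` ~` B -> E A (f + g) = E A g.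
  move=> mA AB; rewrite E_add// -[in E A f]fB E_disjoint ?add0r//.
  exact/disjoints_subset.
have IB : (\int[m]_(x in B) x%:E = \int[m1]_(x in setT) x%:E)%E.
  rewrite (spectral_integral_restrict lf m1E mB fB).
  apply: eq_measure_integral => A mA AB.
  by rewrite (spectral_mE lfg mE)// (spectral_mE lf m1E)// EB.
have IC : (\int[m]_(x in ~` B) x%:E = \int[m2]_(x in setT) x%:E)%E.
  rewrite (spectral_integral_restrict lg m2E mCB gB).
  apply: eq_measure_integral => A mA AB.
  by rewrite (spectral_mE lfg mE)// (spectral_mE lg m2E)// EC.
have IT : (\int[m]_(x in setT) x%:E =
    \int[m1]_(x in setT) x%:E + \int[m2]_(x in setT) x%:E)%E.
  rewrite -IB -IC -integral_setU ?setUv//.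
  by rewrite disj_set2E setICr.
have fin1 : (\int[m1]_(x in setT) x%:E)%E \is a fin_num.
  by apply: integrable_fin_num => //; exact: spectral_integrable m1E.
have fin2 : (\int[m2]_(x in setT) x%:E)%E \is a fin_num.
  by apply: integrable_fin_num => //; exact: spectral_integrable m2E.
have lTf := T_l2 lf; have lTg := T_l2 lg.
have := rinner_integral lfg mE.
rewrite IT fineD// -(rinner_integral lf m1E) -(rinner_integral lg m2E).
rewrite T_add rinnerDl ?rinnerDr//.
by rewrite (T_sym lg lf) (rinnerC g); lra.
Qed.

(** The component of [T (E B f)] in the complement of [B] is orthogonal to itself, by
    [T_orthogonal]. *)
Lemma E_T_E B f : measurable B -> l2 f -> E B (T (E B f)) = T (E B f).
Proof.
move=> mB lf; have mCB := measurableC mB.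
have lE := E_l2 mB lf; have lT := T_l2 lE; have lC := E_l2 mCB lT.
rewrite [RHS](E_setC mB)// (_ : E (~` B) _ = 0) ?addr0//.
apply: rinner_eq0 => //; rewrite E_sym// E_idem//.
by apply: (T_orthogonal mB); rewrite ?E_idem.
Qed.

Lemma E_T_comm B f : measurable B -> l2 f -> E B (T f) = T (E B f).
Proof.
move=> mB lf; have mCB := measurableC mB.
have lE := E_l2 mB lf; have lC := E_l2 mCB lf.
rewrite [in LHS](E_setC mB lf) T_add E_add ?E_T_E//; try exact: T_l2.
rewrite -(E_T_E mCB lf) E_disjoint ?addr0//; first exact: setICr.
exact: T_l2.
Qed.

(** On the range of [E B] the form of [S = T - c] lies between 0 and h times the squared norm.
    Cauchy-Schwarz for this form, applied to [f] and [S f], gives |S f|^4 <= (S f, f) (S S f, S f)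
    <= h^2 |f|^2 |S f|^2. *)
Lemma T_near_scalar B (c h : R) f : measurable B -> 0 <= h ->
  (forall x, B x -> c <= x <= c + h) -> l2 f -> E B f = f ->
  rnorm (T f - c%:C%C *: f) <= h * rnorm f.
Proof.
move=> mB h0 Bch lf fB.
pose S g := T g - c%:C%C *: g.
have S_l2 g : l2 g -> l2 (S g) by move=> lg; apply: l2B; [exact: T_l2|exact: l2Z].
have S_sym g k : l2 g -> l2 k -> rinner (S g) k = rinner g (S k).
  move=> lg lk; have := l2Z c%:C%C lg; have := l2Z c%:C%C lk => lck lcg.
  rewrite rinnerBl ?rinnerBr ?T_sym ?rinnerZl ?rinnerZr//; exact: T_l2.
have SB g : l2 g -> E B g = g -> E B (S g) = S g.
  move=> lg gB; have lT := T_l2 lg; have lc := l2Z c%:C%C lg.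
  rewrite /S -[in RHS]gB -(E_T_comm mB lg) -E_scale// -scaleN1r.
  by rewrite -[in RHS]scaleN1r -[in RHS]E_scale// -E_add//; exact: l2Z.
have Sbound g : l2 g -> E B g = g -> 0 <= rinner (S g) g <= h * rinner g g.
  move=> lg gB; have [m mE] := spectral_measure_measure lg.
  have /andP[] := rinner_integral_bounds lg mE mB gB Bch.
  rewrite /S rinnerBl ?rinnerZl//; [|exact: T_l2|exact: l2Z].
  by move=> h1 h2; apply/andP; split; lra.
have lS := S_l2 f lf; have SfB := SB f lf fB.
have /andP[a0 a1] := Sbound f lf fB.
have /andP[b0 b1] := Sbound (S f) lS SfB.
set N := rinner (S f) (S f) in b1.
have N0 : 0 <= N by exact: rinner_ge0.
(* Discriminant of t |-> (S (f + t S f), f + t S f), which is nonnegative. *)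
have : N ^+ 2 <= rinner (S f) f * rinner (S (S f)) (S f).
  apply: quadratic_discr => // t.
  have ltS := l2Z t%:C%C lS.
  have := Sbound (f + t%:C%C *: S f) (l2D lf ltS).
  rewrite E_add// E_scale// fB SfB => /(_ erefl) /andP[+ _].
  have -> : S (f + t%:C%C *: S f) = S f + t%:C%C *: S (S f).
    rewrite /S T_add T_scale scalerDr opprD addrACA; congr (_ + _).
    by rewrite [RHS]scalerBr !scalerA mulrC.
  have lSS := S_l2 _ lS; have ltSS := l2Z t%:C%C lSS.
  rewrite (rinnerDl lS ltSS (l2D lf ltS)) (rinnerDr lf ltS lS).
  rewrite (rinnerDr lf ltS ltSS) (rinnerZr _ lS lS) (rinnerZl _ lSS lf).
  rewrite (rinnerZl _ lSS ltS) (rinnerZr _ lS lSS) (S_sym _ _ lS lf) -/N.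
  by move=> le; rewrite (le_trans le)// le_eqVlt; apply/orP; left; apply/eqP; ring.
move=> N2; have f0 := rinner_ge0 lf.
have N3 : N ^+ 2 <= h ^+ 2 * rinner f f * N.
  apply: (le_trans N2); have := ler_pM a0 b0 a1 b1; rewrite -/N => le.
  by rewrite (le_trans le)//; lra.
have N4 : N <= h ^+ 2 * rinner f f.
  have [->|nN] := eqVneq N 0; first by rewrite mulr_ge0 ?sqr_ge0.
  have Np : 0 < N by rewrite lt0r nN.
  by rewrite -(ler_pM2r Np) -expr2.
rewrite -(ler_pXn2r (n := 2)) ?nnegrE ?mulr_ge0 ?rnorm_ge0//.
by rewrite exprMn !rnorm_sqr.
Qed.

(** On this range (T g, g) <= - d |g|^2, against positivity. Intersecting with [- r, r] supplies the
    lower bound that [rinner_integral_bounds] also asks for. *)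
Lemma E_below0 (d : R) f : (forall g, l2 g -> 0 <= rinner (T g) g) -> 0 < d ->
  l2 f -> E [set` `]-oo, - d]] f = 0.
Proof.
move=> T_ge0 d0 lf; have [r r0 hr] := E_bounded.
have mI : measurable ([set` `[- r, r]] : set (measurableTypeR R)).
  exact: measurable_itv.
have mJ : measurable ([set` `]-oo, - d]] : set (measurableTypeR R)).
  exact: measurable_itv.
set g := E _ f; have lg : l2 g by exact: E_l2.
have mIJ := measurableI _ _ mI mJ.
have gB : E ([set` `[- r, r]] `&` [set` `]-oo, - d]]) g = g.
  by rewrite (pvm_setI hE)// {1}/g E_idem// hr.
have [m mE] := spectral_measure_measure lg.
have := rinner_integral_bounds (c := - r) (d := - d) lg mE mIJ gB.
case/(_ _)/andP => [x []/=|_].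
  by rewrite !in_itv/= => /andP[-> _] ->.
have := T_ge0 _ lg; have := rinner_ge0 lg => h1 h2 h3.
by apply: rinner_eq0 => //; apply/eqP; rewrite eq_le h1 andbT; nra.
Qed.

(** * Decomposition of vectors along half-open cells of length [h] *)

Section Partition.
Variables (c0 h : R) (n : nat).
Hypothesis h0 : 0 <= h.
Hypothesis covers : exists r, [/\ c0 <= - r, r < c0 + n%:R * h &
  forall f, l2 f -> E [set` `[- r, r]] f = f].

Definition cell (k : nat) : set (measurableTypeR R) :=
  [set` `[c0 + k%:R * h, c0 + k.+1%:R * h[].

Lemma measurable_cell k : measurable (cell k).
Proof. exact: measurable_itv. Qed.

Lemma sum_cell f : l2 f ->
  rinner f f = \sum_(k < n) rinner (E (cell k) f) (E (cell k) f).
Proof.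
move=> lf; have [r [c0r rc fr]] := covers.
have mI a b : measurable ([set` `[a, b[] : set (measurableTypeR R)).
  exact: measurable_itv.
have partial j : \sum_(k < j) rinner (E (cell k) f) (E (cell k) f) =
    rinner (E [set` `[c0, c0 + j%:R * h[] f) (E [set` `[c0, c0 + j%:R * h[] f).
  elim: j => [|j IH].
    rewrite big_ord0 mul0r addr0 set_itvco0 E_set0// rinner0l//; exact: l20.
  have le1 : c0 <= c0 + j%:R * h by rewrite lerDl mulr_ge0.
  have le2 : c0 + j%:R * h <= c0 + j.+1%:R * h.
    by rewrite lerD2l ler_wpM2r// ler_nat.
  have U : [set` `[c0, c0 + j.+1%:R * h[] =
      [set` `[c0, c0 + j%:R * h[] `|` cell j :> set (measurableTypeR R).
    apply/seteqP; split => x /=; rewrite !in_itv/=.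
      move=> /andP[h1 h2]; case: (ltP x (c0 + j%:R * h)) => h3.
        by left; rewrite h1.
      by right; rewrite /cell /= in_itv/= h3.
    move=> [/andP[h1 h2]|]; first by rewrite h1 (lt_le_trans h2).
    by rewrite /cell /= in_itv/= => /andP[h1 h2]; rewrite (le_trans le1).
  have D : [set` `[c0, c0 + j%:R * h[] `&` cell j = set0 :> set (measurableTypeR R).
    rewrite -subset0 => x [] /=; rewrite /cell /= !in_itv/=.
    by move=> /andP[_ h1] /andP[h2 _]; move: (lt_le_trans h1 h2); rewrite ltxx.
  have mc := measurable_cell j.
  have l1 := E_l2 (mI c0 (c0 + j%:R * h)) lf; have l2' := E_l2 mc lf.
  rewrite big_ord_recr/= IH U E_setU// rinner_sqrD//.
  by rewrite (E_orthogonal (mI c0 _) mc D lf lf) mulr0 addr0.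
(* The union of the cells is open on the right, hence the strict inequality [r < c0 + n%:R * h] in
   [covers]. *)
rewrite partial (_ : E _ f = f)// -[in LHS](fr f lf) -(pvm_setI hE)//.
rewrite setIidr ?fr// => x /=; rewrite !in_itv/= => /andP[h1 h2].
by rewrite (le_trans c0r)// (le_lt_trans h2).
Qed.

(** [b k] is the squared norm of the part of [f] in the cell and below [s]. Only a cell straddling
    [s] leaves it undetermined. In this form the distribution function can be handed to
    [stieltjes_asymptotics], where no operator appears. *)
Lemma cell_below s f : l2 f -> exists b : nat -> R,
  [/\ spectral_measure E f [set` `]-oo, s]] = \sum_(k < n) b k,
    forall k, 0 <= b k <= rinner (E (cell k) f) (E (cell k) f),
    forall k, s < c0 + k%:R * h -> b k = 0 &
    forall k, c0 + k.+1%:R * h <= s ->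
      b k = rinner (E (cell k) f) (E (cell k) f)].
Proof.
move=> lf; pose J : set (measurableTypeR R) := [set` `]-oo, s]].
have mJ : measurable J by exact: measurable_itv.
have lJ := E_l2 mJ lf.
exists (fun k => rinner (E (cell k) (E J f)) (E (cell k) (E J f))).
split => [|k|k sk|k ks].
- by rewrite spectral_measureE// sum_cell.
- have mc := measurable_cell k; have lc := E_l2 mc lf.
  rewrite rinner_ge0 ?andTb; last exact: E_l2.
  rewrite -(pvm_setI hE)// setIC (pvm_setI hE)//.
  have mCJ := measurableC mJ.
  have lJc := E_l2 mJ lc; have lCJc := E_l2 mCJ lc.
  rewrite [leRHS](_ : _ = rinner (E J (E (cell k) f)) (E J (E (cell k) f)) +
    rinner (E (~` J) (E (cell k) f)) (E (~` J) (E (cell k) f))).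
    by rewrite lerDl rinner_ge0.
  rewrite [in LHS](E_setC mJ lc) rinner_sqrD//.
  by rewrite (E_orthogonal mJ mCJ (setICr J) lc lc) mulr0 addr0.
- rewrite E_disjoint//; first by rewrite rinner0l//; exact: l20.
    exact: measurable_cell.
  rewrite -subset0 => x [] /=; rewrite /cell /J /= !in_itv/=.
  by move=> /andP[h1 _] h2; have := lt_le_trans sk h1; rewrite ltNge h2.
- rewrite E_subset//; first exact: measurable_cell.
  move=> x; rewrite /cell /J /= !in_itv/= => /andP[_ h1].
  by rewrite (le_trans (ltW h1)).
Qed.

End Partition.

(* On a cell of the partition T acts almost as multiplication by c, so that
   |c - z|^2 ||E u||^2 is close to ||E (T - z) u||^2. *)
Lemma cell_resolvent B (c h e t : R) (u v : X -> R[i]) : measurable B ->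
  0 < e -> e <= 1 -> h = e ^+ 2 ->
  (forall x, B x -> c <= x <= c + h) -> l2 u ->
  T u - (Complex t e) *: u = v ->
  `|rinner (E B v) (E B v) * (e / ((t - c) ^+ 2 + e ^+ 2)) -
    e * rinner (E B u) (E B u)| <= 3 * e * (e * rinner (E B u) (E B u)).
Proof.
move=> mB e0 e1 hE2 Bch lu uv.
set f := E B u; have lf : l2 f by exact: E_l2.
have fB : E B f = f by exact: E_idem.
have lTf := T_l2 lf.
have h0 : 0 <= h by rewrite hE2 sqr_ge0.
have := T_near_scalar mB h0 Bch lf fB.
set w := T f - _ => wle; have lw : l2 w by apply: l2B => //; exact: l2Z.
have lTu := T_l2 lu; have lzu := l2Z (Complex t e) lu.
(* [E B] commutes with [T - z], and T - z = (T - c) + (c - z); [w] is the error of replacing [T] by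
   [c]. *)
have Ev : E B v = w + (Complex (c - t) (- e)) *: f.
  rewrite -uv -scaleNr E_add ?E_scale ?E_T_comm//; last exact: l2Z.
  rewrite -/f /w -addrA -scaleNr -scalerDl; congr (_ + _ *: _).
  by apply/eqP; rewrite eq_complex /=; apply/andP; split; apply/eqP; ring.
set d := Complex (c - t) (- e) in Ev.
have ld := l2Z d lf.
have lv : l2 (E B v) by rewrite Ev; exact: l2D.
set y := rnorm f in wle *; set x := rnorm (E B v).
set D := Normc.normc d.
have D2 : D ^+ 2 = (t - c) ^+ 2 + e ^+ 2.
  by rewrite /D /= sqr_sqrtr ?addr_ge0 ?sqr_ge0//; ring.
have D0 : 0 <= D by exact: sqrtr_ge0.
have De : e <= D.
  rewrite -(ler_pXn2r (n := 2)) ?nnegrE ?(ltW e0)// D2 lerDr sqr_ge0//.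
have x1 : x <= h * y + D * y.
  by rewrite /x Ev (le_trans (rnorm_triangle lw ld))// rnormZ// lerD2r.
have x2 : D * y <= x + h * y.
  rewrite -rnormZ// -/d (_ : d *: f = E B v + - w); last first.
    by rewrite Ev addrC addKr.
  rewrite (le_trans (rnorm_triangle lv (l2N lw)))// lerD2l.
  by rewrite (_ : rnorm (- w) = rnorm w)// /rnorm rinnerNl ?rinnerNr ?opprK//;
    exact: l2N.
have y0 : 0 <= y by exact: rnorm_ge0.
have x0 : 0 <= x by exact: rnorm_ge0.
rewrite -!rnorm_sqr// -/x -/y -D2.
have Dp : 0 < D by exact: lt_le_trans De.
have main : `|x ^+ 2 - D ^+ 2 * y ^+ 2| <= 3 * e * (D ^+ 2 * y ^+ 2).
  (* [D] = |c - z| is at least Im z = [e], so a mesh of [e ^+ 2] makes the error [w] a fraction [e]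
     of the main term; squaring costs 2 e + e^2 <= 3 e. *)
  have hD : h <= e * D by rewrite hE2 expr2 ler_wpM2l// ltW.
  have b1 : x <= (1 + e) * (D * y).
    by rewrite (le_trans x1)// mulrDl mul1r addrC lerD2l mulrA ler_wpM2r.
  have b2 : (1 - e) * (D * y) <= x.
    have : h * y <= e * D * y by rewrite ler_wpM2r.
    by lra.
  have Dy : 0 <= D * y by rewrite mulr_ge0.
  rewrite -exprMn; move: (D * y) Dy b1 b2 => w0 w00 b1 b2.
  rewrite ler_norml; apply/andP; split.
    have : ((1 - e) * w0) ^+ 2 <= x ^+ 2.
      by rewrite ler_pXn2r// nnegrE mulr_ge0// subr_ge0.
    have := sqr_ge0 w0; nra.
  have : x ^+ 2 <= ((1 + e) * w0) ^+ 2.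
    by rewrite ler_pXn2r// nnegrE mulr_ge0// addr_ge0// ltW.
  have := sqr_ge0 w0; nra.
rewrite (_ : _ - _ = (e / D ^+ 2) * (x ^+ 2 - D ^+ 2 * y ^+ 2)); last first.
  by field; rewrite gt_eqF.
rewrite normrM ger0_norm; last by rewrite divr_ge0 ?sqr_ge0// ltW.
rewrite [leRHS](_ : _ = (e / D ^+ 2) * (3 * e * (D ^+ 2 * y ^+ 2))); last first.
  by field; rewrite gt_eqF.
by rewrite ler_wpM2l// divr_ge0 ?sqr_ge0// ltW.
Qed.

End Commutation.

End SpectralResolution.

(** * The Laplace operator on the orbit of 1/2 *)

Section Reindexing.
Variables (R : realType) (X : choiceType).
Implicit Types (f g : X -> R[i]).

Lemma l2_comp (e : X -> X) f : bijective e -> l2 f -> l2 (f \o e).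
Proof.
move=> be /l2E lf; apply/l2E.
exact: (iffRL (rsummable_bij (fun x => redot (f x) (f x)) be)).
Qed.

Lemma rinner_comp (e : X -> X) f g : bijective e ->
  rinner (f \o e) (g \o e) = rinner f g.
Proof. by move=> be; exact: (rsum_bij (fun x => redot (f x) (g x)) be). Qed.

Lemma rinner_compC (e e' : X -> X) f g : cancel e e' -> cancel e' e ->
  rinner (f \o e) g = rinner f (g \o e').
Proof.
move=> eK e'K; have be' : bijective e' by exists e.
rewrite -(rinner_comp (f \o e) g be') (_ : (f \o e) \o e' = f)//.
by apply/funext => x /=; rewrite e'K.
Qed.

Lemma rinner_comp_le (e : X -> X) f : bijective e -> l2 f ->
  rinner (f \o e) f <= rinner f f.
Proof.
move=> be lf; rewrite (le_trans (rinner_CS (l2_comp be lf) lf))//.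
by rewrite /rnorm rinner_comp// -expr2 sqr_sqrtr// rinner_ge0.
Qed.

End Reindexing.

Section Laplace.
Variable R : realType.
Notation X := (orbit_half R).
Implicit Types f g : X -> R[i].

Definition oa : X -> X := orbit_act (@thompsonF_a R).
Definition oaV : X -> X := orbit_act (@thompsonF_aV R).
Definition ob : X -> X := orbit_act (@thompsonF_b R).
Definition obV : X -> X := orbit_act (@thompsonF_bV R).

Let oaK : cancel oa oaV.
Proof. by move=> y; apply: val_inj; exact: gen_aK. Qed.
Let oaVK : cancel oaV oa.
Proof. by move=> y; apply: val_inj; exact: gen_aVK. Qed.
Let obK : cancel ob obV.
Proof. by move=> y; apply: val_inj; exact: gen_bK. Qed.
Let obVK : cancel obV ob.
Proof. by move=> y; apply: val_inj; exact: gen_bVK. Qed.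

Let ba : bijective oa. Proof. by exists oaV. Qed.
Let baV : bijective oaV. Proof. by exists oa. Qed.
Let bb : bijective ob. Proof. by exists obV. Qed.
Let bbV : bijective obV. Proof. by exists ob. Qed.

Let S f : X -> R[i] := (f \o oa) + (f \o oaV) + (f \o ob) + (f \o obV).

Let laplaceE f : laplace R f = f - (1 / 4)%:C%C *: S f.
Proof.
apply/funext => y; rewrite /laplace !fctE /markov_op /S.
have -> : (1 / 4)%:C%C = 1 / 4 :> R[i].
  by rewrite rmorphM rmorph1 fmorphV rmorph_nat.
by [].
Qed.

Let S_l2 f : l2 f -> l2 (S f).
Proof.
move=> lf; exact: (l2D (l2D (l2D (l2_comp ba lf) (l2_comp baV lf))
  (l2_comp bb lf)) (l2_comp bbV lf)).
Qed.

Let rinner_S f g : l2 f -> l2 g -> rinner (S f) g =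
  rinner (f \o oa) g + rinner (f \o oaV) g +
  rinner (f \o ob) g + rinner (f \o obV) g.
Proof.
move=> lf lg; have la := l2_comp ba lf; have laV := l2_comp baV lf.
have lb := l2_comp bb lf; have lbV := l2_comp bbV lf.
have l1 := l2D la laV; have l2' := l2D l1 lb.
by rewrite /S (rinnerDl l2' lbV lg) (rinnerDl l1 lb lg) (rinnerDl la laV lg).
Qed.

Lemma laplace_l2 f : l2 f -> l2 (laplace R f).
Proof. by move=> lf; rewrite laplaceE; apply: l2B => //; apply: l2Z; exact: S_l2. Qed.

Lemma laplaceP f (y : X) : laplace R f y =
  f y - (f (oa y) + f (oaV y) + f (ob y) + f (obV y)) / 4.
Proof. by rewrite -[LHS]/(f y - markov_op f y) /markov_op mul1r mulrC. Qed.

Lemma laplace_add f g : laplace R (f + g) = laplace R f + laplace R g.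
Proof.
apply/funext => y; have DE h k x : (h + k : X -> R[i]) x = h x + k x by [].
by rewrite DE !laplaceP !DE; ring.
Qed.

Lemma laplace_scale (c : R[i]) f : laplace R (c *: f) = c *: laplace R f.
Proof.
apply/funext => y; transitivity (c * laplace R f y); last by [].
have sE x : (c *: f : X -> R[i]) x = c * f x by [].
by rewrite !laplaceP !sE; ring.
Qed.

Lemma laplace_sym f g : l2 f -> l2 g ->
  rinner (laplace R f) g = rinner f (laplace R g).
Proof.
move=> lf lg; have lSf := S_l2 lf; have lSg := S_l2 lg.
have lZf := l2Z (1 / 4)%:C%C lSf; have lZg := l2Z (1 / 4)%:C%C lSg.
rewrite !laplaceE rinnerBl// rinnerBr// rinnerZl// rinnerZr//.
rewrite (rinnerC f (S g)) !rinner_S// (rinner_compC _ _ oaK oaVK).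
rewrite (rinner_compC _ _ oaVK oaK) (rinner_compC _ _ obK obVK).
rewrite (rinner_compC _ _ obVK obK) !(rinnerC f).
by ring.
Qed.

(** The generators permute the orbit, so by Cauchy-Schwarz each of the four terms of the average is
    at most (f, f). *)
Lemma laplace_ge0 f : l2 f -> 0 <= rinner (laplace R f) f.
Proof.
move=> lf; have lS := S_l2 lf; have lZ := l2Z (1 / 4)%:C%C lS.
rewrite laplaceE rinnerBl// rinnerZl// rinner_S//.
have := rinner_comp_le ba lf; have := rinner_comp_le baV lf.
have := rinner_comp_le bb lf; have := rinner_comp_le bbV lf; lra.
Qed.

End Laplace.

(** * The tree structure of the Schreier graph *)

Section Tree.
Variable R : realType.
Notation X := (orbit_half R).
Implicit Types x : R.

Ltac regions :=
  rewrite /b_fun /bV_fun /a_fun /aV_fun;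
  repeat match goal with
  | |- context [if (?u < ?v)%R then _ else _] =>
      lazymatch u with context [if _ then _ else _] => fail | _ => idtac end;
      case: (ltP u v) => ? /=
  end; lra.

(* The Schreier graph is a tree rooted at 1/2, up to loops and double edges: each
   generator fixes x, moves it to its parent, or moves it to a child. The points
   of (0, 1/4) and [7/8, 1) lie on rays leaving [1/4, 1/2) and [3/4, 7/8). *)
Definition parent (x : R) : R :=
  if x < 1 / 4 then 2 * x else if x < 1 / 2 then x + 1 / 4
  else if x < 5 / 8 then 2 * x - 1 / 2 else if x < 3 / 4 then x + 1 / 8
  else 2 * x - 1.

(** Iterating [parent] need not reach 1/2 from an arbitrary real, so the recursion is on a bound [n]
    for the depth. *)
Fixpoint rooted (n : nat) (x : R) : bool :=
  (x == 1 / 2) || (if n is n'.+1 then rooted n' (parent x) else false).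

Definition in_tree (x : R) : Prop := exists n, rooted n x.

Lemma in_tree_parent x : x != 1 / 2 -> in_tree (parent x) <-> in_tree x.
Proof.
move=> x2; split => -[n nx]; first by exists n.+1; rewrite /= nx orbT.
case: n nx => [|n] /=; first by rewrite orbF (negbTE x2).
by rewrite (negbTE x2) => nx; exists n.
Qed.

Lemma half_lt (x : R) : x < 1 / 2 -> x != 1 / 2.
Proof. by move=> h; rewrite lt_eqF. Qed.

Lemma half_gt (x : R) : 1 / 2 < x -> x != 1 / 2.
Proof. by move=> h; rewrite gt_eqF. Qed.

Lemma a_fun_child x : x < 3 / 4 -> parent (a_fun x) = x /\ a_fun x != 1 / 2.
Proof.
move=> h; split; first by rewrite /parent; regions.
by apply: half_lt; regions.
Qed.

Lemma a_fun_parent x : 3 / 4 <= x -> a_fun x = parent x /\ x != 1 / 2.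
Proof.
move=> h; split; first by rewrite /parent; regions.
by apply: half_gt; lra.
Qed.

Lemma b_fun_fix x : x <= 1 / 2 -> b_fun x = x.
Proof. by move=> h; regions. Qed.

Lemma b_fun_child x : 1 / 2 < x -> x < 7 / 8 ->
  parent (b_fun x) = x /\ b_fun x != 1 / 2.
Proof.
move=> h h'; split; first by rewrite /parent; regions.
by apply: half_gt; regions.
Qed.

Lemma b_fun_parent x : 7 / 8 <= x -> b_fun x = parent x /\ x != 1 / 2.
Proof.
move=> h; split; first by rewrite /parent; regions.
by apply: half_gt; lra.
Qed.

Lemma a_fun_lt x : x < 3 / 4 -> a_fun x < 1 / 2.
Proof. by move=> h; regions. Qed.

Lemma aV_fun_parent x : x < 1 / 2 -> aV_fun x = parent x.
Proof. by move=> h; rewrite /parent; regions. Qed.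

Lemma aV_fun_child x : 1 / 2 <= x -> parent (aV_fun x) = x /\ aV_fun x != 1 / 2.
Proof.
move=> h; split; first by rewrite /parent; regions.
by apply: half_gt; regions.
Qed.

Lemma aV_fun_ge34 x : 1 / 2 <= x -> 3 / 4 <= aV_fun x.
Proof. by move=> h; regions. Qed.

Lemma aV_fun_lt78 x : x < 3 / 4 -> aV_fun x < 7 / 8.
Proof. by move=> h; regions. Qed.

Lemma aV_fun_ge78 x : 3 / 4 <= x -> 7 / 8 <= aV_fun x.
Proof. by move=> h; regions. Qed.

Lemma b_fun_gt x : 1 / 2 < x -> 1 / 2 < b_fun x.
Proof. by move=> h; regions. Qed.

Lemma b_fun_lt x : x < 7 / 8 -> b_fun x < 3 / 4.
Proof. by move=> h; regions. Qed.

Lemma bV_fun_fix x : x <= 1 / 2 -> bV_fun x = x.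
Proof. by move=> h; regions. Qed.

Lemma bV_fun_parent x : 1 / 2 < x -> x < 3 / 4 -> bV_fun x = parent x.
Proof. by move=> h h'; rewrite /parent; regions. Qed.

Lemma bV_funE x : 3 / 4 <= x -> bV_fun x = aV_fun x.
Proof. by move=> h; regions. Qed.

Lemma bV_fun_gt x : 1 / 2 < x -> 1 / 2 < bV_fun x.
Proof. by move=> h; regions. Qed.

Lemma bV_fun_lt x : x < 3 / 4 -> bV_fun x < 7 / 8.
Proof. by move=> h; regions. Qed.

Lemma a_fun_ge x : 3 / 4 <= x -> 1 / 2 <= a_fun x.
Proof. by move=> h; regions. Qed.

Lemma aV_fun_lt x : x < 1 / 2 -> aV_fun x < 3 / 4.
Proof. by move=> h; regions. Qed.

Lemma in_tree_a x : in_tree (a_fun x) <-> in_tree x.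
Proof.
case: (ltP x (3 / 4)) => [/a_fun_child|/a_fun_parent] [e ne].
  by rewrite -[in in_tree x]e in_tree_parent.
by rewrite e in_tree_parent.
Qed.

Lemma in_tree_b x : in_tree (b_fun x) <-> in_tree x.
Proof.
case: (leP x (1 / 2)) => [/b_fun_fix ->//|h].
case: (ltP x (7 / 8)) => [/(b_fun_child h)|/b_fun_parent] [e ne].
  by rewrite -[in in_tree x]e in_tree_parent.
by rewrite e in_tree_parent.
Qed.

(** An equivalence rather than an implication: the case of an inverse reads the hypothesis on [g1]
    at [h y] backwards. *)
Lemma in_tree_thompsonF (g : unit_interval R -> unit_interval R) : thompsonF g ->
  forall y, in_tree (sval (g y)) <-> in_tree (sval y).
Proof.
elim => [//|y|y|g1 g2 _ IH1 _ IH2 y|g1 h _ IH gK hK y].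
- exact: in_tree_a.
- exact: in_tree_b.
- by rewrite /= IH1 IH2.
- by rewrite -[in X in _ <-> X](hK y) IH.
Qed.

Lemma in_tree_half : in_tree (1 / 2).
Proof. by exists 0%N; rewrite /= eqxx. Qed.

Definition pt (y : X) : R := sval (sval y).

Lemma pt_inj : injective pt.
Proof. by move=> y y' h; apply: val_inj; apply: val_inj. Qed.

Lemma in_tree_orbit (y : X) : in_tree (pt y).
Proof.
have /set_mem[g Fg gy] := svalP y; rewrite /pt -gy.
by apply/(in_tree_thompsonF Fg); exact: in_tree_half.
Qed.

(** * The resolvent vector as a multiplicative function on the tree *)

Section TreeFunction.
Variables (z p q w v G : R[i]).

(* Ratio of the values at x and at its parent. *)
Definition mult (x : R) : R[i] :=
  if x < 1 / 2 then p else if x < 3 / 4 then v else if x < 7 / 8 then w else q.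

Lemma mult_p x : x < 1 / 2 -> mult x = p.
Proof. by rewrite /mult => ->. Qed.

Lemma mult_v x : 1 / 2 <= x -> x < 3 / 4 -> mult x = v.
Proof. by move=> h h'; rewrite /mult ltNge h h'. Qed.

Lemma mult_w x : 3 / 4 <= x -> x < 7 / 8 -> mult x = w.
Proof.
by move=> h h'; rewrite /mult ltNge (le_trans _ h) ?ltNge ?h//= -?ltNge ?h'//; lra.
Qed.

Lemma mult_q x : 7 / 8 <= x -> mult x = q.
Proof. by move=> h; rewrite /mult !ltNge h !(le_trans _ h)//; lra. Qed.

Fixpoint tree_val (n : nat) (x : R) : R[i] :=
  if x == 1 / 2 then G
  else if n is n'.+1 then mult x * tree_val n' (parent x) else 0.

Lemma tree_val_stable n m x : rooted n x -> (n <= m)%N ->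
  tree_val m x = tree_val n x.
Proof.
elim: n m x => [|n IH] m x /=.
  by rewrite orbF => /eqP ->; case: m => [|m] _ /=; rewrite eqxx.
case: (eqVneq x (1 / 2)) => [->|nx /=]; first by case: m => [|m] _ _ /=; rewrite eqxx.
by case: m => [//|m] /= h; rewrite ltnS (negbTE nx) => nm; rewrite IH.
Qed.

(** By [tree_val_stable] every sufficient depth gives the same value, so the depth picked by [xget]
    does not matter. *)
Definition tree_fun (x : R) : R[i] := tree_val (xget 0%N [set n | rooted n x]) x.

Lemma tree_fun_val n x : rooted n x -> tree_fun x = tree_val n x.
Proof.
move=> nx; rewrite /tree_fun; case: xgetP => [m _ /= mx|/(_ n)]; last by [].
case/orP: (leq_total m n) => h; first by rewrite (tree_val_stable mx h).
by rewrite (tree_val_stable nx h).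
Qed.

Lemma tree_fun_half : tree_fun (1 / 2) = G.
Proof. by rewrite (@tree_fun_val 0) /= eqxx. Qed.

Lemma tree_fun_parent x : in_tree x -> x != 1 / 2 ->
  tree_fun x = mult x * tree_fun (parent x).
Proof.
move=> [n nx] x2; case: n nx => [|n] /=; first by rewrite orbF (negbTE x2).
rewrite (negbTE x2)/= => nx; rewrite (tree_fun_val nx).
by rewrite (@tree_fun_val n.+1) /= (negbTE x2)// nx.
Qed.

Lemma tree_fun_child x y : in_tree x -> parent y = x -> y != 1 / 2 ->
  tree_fun y = mult y * tree_fun x.
Proof.
move=> tx yx y2; rewrite -yx tree_fun_parent//.
by apply/(in_tree_parent y2); rewrite yx.
Qed.

Hypothesis p0 : p != 0.
Hypothesis q0 : q != 0.
(** The resolvent equation at each type of vertex: [hp] on the left ray, where b gives two loops;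
    [hq] on the right ray, where a and b give double edges; [hw] on [3/4, 7/8), [hv] on (1/2, 3/4),
    and [hG] at the root. In the last three z is eliminated by [hp] or [hq]; for instance 4 - 4 z =
    1/w + 2 q + v becomes 1/w = 2/q - v. *)
Hypothesis hp : p + p^-1 = 2 - 4 * z.
Hypothesis hq : q + q^-1 = 2 - 2 * z.
Hypothesis hw : w * (2 / q - v) = 1.
Hypothesis hv : v * (2 + p^-1 - w - v) = 1.
Hypothesis hG : G * (p^-1 - w) = 4.

Let w0 : w != 0.
Proof. by apply/eqP => e; move: hw; rewrite e mul0r => /eqP; rewrite eq_sym oner_eq0. Qed.
Let v0 : v != 0.
Proof. by apply/eqP => e; move: hv; rewrite e mul0r => /eqP; rewrite eq_sym oner_eq0. Qed.

Let wV : w^-1 = 2 / q - v.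
Proof. by apply: (mulfI w0); rewrite mulfV// hw. Qed.
Let vV : v^-1 = 2 + p^-1 - w - v.
Proof. by apply: (mulfI v0); rewrite mulfV// hv. Qed.
Let pV : p^-1 = 2 - 4 * z - p.
Proof. by rewrite -hp addrC addKr. Qed.
Let qV : q^-1 = 2 - 2 * z - q.
Proof. by rewrite -hq addrC addKr. Qed.

Lemma tree_fun_up x : in_tree x -> x != 1 / 2 ->
  tree_fun (parent x) = (mult x)^-1 * tree_fun x.
Proof.
move=> tx x2; rewrite (tree_fun_parent tx x2) mulKf//.
by rewrite /mult; do !case: ifP => _.
Qed.

Lemma tree_fun_laplace x : in_tree x ->
  tree_fun x - (tree_fun (a_fun x) + tree_fun (aV_fun x) +
                tree_fun (b_fun x) + tree_fun (bV_fun x)) / 4 - z * tree_fun x =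
  (x == 1 / 2)%:R.
Proof.
move=> tx; case: (ltP x (1 / 2)) => [x1|x1].
  have x2 := half_lt x1; have x3 : x < 3 / 4 by lra.
  have [h1 h2] := a_fun_child x3.
  rewrite (b_fun_fix (ltW x1)) (bV_fun_fix (ltW x1)) (aV_fun_parent x1).
  rewrite (tree_fun_child tx h1 h2) (tree_fun_up tx x2) (negbTE x2).
  by rewrite (mult_p x1) (mult_p (a_fun_lt x3)) pV mulr0n; field.
have [h3 h4] := aV_fun_child x1; rewrite (tree_fun_child tx h3 h4).
case: (ltP x (3 / 4)) => [x3|x3].
  have [h1 h2] := a_fun_child x3.
  rewrite (tree_fun_child tx h1 h2) (mult_p (a_fun_lt x3)).
  rewrite (mult_w (aV_fun_ge34 x1) (aV_fun_lt78 x3)).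
  case: (eqVneq x (1 / 2)) => [xE|x2].
    have x1' : x <= 1 / 2 by rewrite xE.
    have hG4 : 1 = G * (p^-1 - w) / 4 by rewrite hG divff// pnatr_eq0.
    rewrite (b_fun_fix x1') (bV_fun_fix x1') xE tree_fun_half.
    by rewrite [RHS]hG4 pV; field.
  have xgt : 1 / 2 < x by rewrite lt_def x2.
  have x4 : x < 7 / 8 by lra.
  have [h5 h6] := b_fun_child xgt x4.
  rewrite (bV_fun_parent xgt x3) (tree_fun_child tx h5 h6) (tree_fun_up tx x2).
  rewrite (mult_v (ltW (b_fun_gt xgt)) (b_fun_lt x4)) (mult_v x1 x3).
  by rewrite vV pV mulr0n; field.
have [-> x2] := a_fun_parent x3.
rewrite (bV_funE x3) (tree_fun_child tx h3 h4) (tree_fun_up tx x2) (negbTE x2).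
rewrite (mult_q (aV_fun_ge78 x3)) mulr0n.
case: (ltP x (7 / 8)) => [x4|x4].
  have xgt : 1 / 2 < x by lra.
  have [h5 h6] := b_fun_child xgt x4.
  rewrite (tree_fun_child tx h5 h6) (mult_v (ltW (b_fun_gt xgt)) (b_fun_lt x4)).
  by rewrite (mult_w x3 x4) wV qV; field.
have [-> _] := b_fun_parent x4.
by rewrite (tree_fun_up tx x2) (mult_q x4) qV; field.
Qed.

(** Each child is listed once: on [3/4, 1) the maps [oaV] and [obV] coincide, and up to 1/2 [ob] and
    [obV] are loops. *)
Definition children (y : X) : seq X :=
  if pt y < 1 / 2 then [:: oa y]
  else if pt y == 1 / 2 then [:: oa y; oaV y]
  else if pt y < 3 / 4 then [:: oa y; oaV y; ob y]
  else if pt y < 7 / 8 then [:: ob y; oaV y] else [:: oaV y].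

Fixpoint level (n : nat) : seq X :=
  if n is n'.+1 then flatten [seq children y | y <- level n'] else [:: base_point R].

Lemma rooted_level n (y : X) : rooted n (pt y) -> exists m, y \in level m.
Proof.
elim: n y => [|n IH] y /=.
  rewrite orbF => /eqP yE; exists 0%N; rewrite inE; apply/eqP.
  exact: pt_inj.
case: eqVneq => [yE _|y2 /= ny].
  by exists 0%N; rewrite inE; apply/eqP; exact: pt_inj.
suff [y' y'E yc] : exists2 y' : X, pt y' = parent (pt y) & y \in children y'.
  have [|m ym] := IH y'; first by rewrite y'E.
  by exists m.+1; apply/flatten_mapP; exists y'.
have Ea : oa (oaV y) = y by apply: pt_inj; exact: aV_funK.
have EaV : oaV (oa y) = y by apply: pt_inj; exact: a_funK.
have Eb : ob (obV y) = y by apply: pt_inj; exact: bV_funK.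
have pa y' : pt (oa y') = a_fun (pt y') by [].
have paV y' : pt (oaV y') = aV_fun (pt y') by [].
have pb y' : pt (ob y') = b_fun (pt y') by [].
have pbV y' : pt (obV y') = bV_fun (pt y') by [].
case: (ltP (pt y) (1 / 2)) => [y1|y1].
  exists (oaV y); first by rewrite paV aV_fun_parent.
  have h : pt (oaV y) < 3 / 4 by rewrite paV aV_fun_lt.
  rewrite /children; case: ifP => _; first by rewrite Ea inE.
  case: ifP => _; first by rewrite Ea inE eqxx.
  by rewrite h Ea inE eqxx.
have ygt : 1 / 2 < pt y by rewrite lt_def y2.
case: (ltP (pt y) (3 / 4)) => [y3|y3].
  exists (obV y); first by rewrite pbV bV_fun_parent.
  have h1 : 1 / 2 < pt (obV y) by rewrite pbV bV_fun_gt.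
  have h2 : pt (obV y) < 7 / 8 by rewrite pbV bV_fun_lt.
  rewrite /children ltNge (ltW h1) /= (negbTE (half_gt h1)) h2 Eb.
  by case: ifP => _; rewrite !inE eqxx ?orbT.
exists (oa y); first by rewrite pa; have [] := a_fun_parent y3.
have h1 : 1 / 2 <= pt (oa y) by rewrite pa a_fun_ge.
rewrite /children ltNge h1 /= EaV.
by do !case: ifP => _; rewrite !inE eqxx ?orbT.
Qed.

(** Repetitions in [l] only enlarge the right-hand side, so the levels need not be shown disjoint or
    duplicate-free. *)
Lemma sum_seq_subset (F : X -> R) (s l : seq X) : (forall y, 0 <= F y) ->
  uniq s -> {subset s <= l} -> \sum_(y <- s) F y <= \sum_(y <- l) F y.
Proof.
move=> F0; elim: s l => [|y s IH] l /=.
  by move=> _ _; rewrite big_nil; apply: sumr_ge0.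
move=> /andP[ys us] sl; have yl : y \in l by apply: sl; rewrite inE eqxx.
rewrite big_cons (perm_big _ (perm_to_rem yl)) big_cons lerD2l; apply: IH => // x xs.
have : x \in l by apply: sl; rewrite inE xs orbT.
rewrite (perm_mem (perm_to_rem yl)) inE => /orP[/eqP xy|//].
by move: ys; rewrite -xy xs.
Qed.

(* Phi dominates the sum of F over a subtree, so the sum of F over the first n
   levels telescopes. *)
Lemma level_summable (F Phi : X -> R) : (forall y, 0 <= F y) ->
  (forall y, 0 <= Phi y) ->
  (forall y, F y + \sum_(k <- children y) Phi k <= Phi y) -> rsummable F.
Proof.
move=> F0 Phi0 h.
have step n : \sum_(j < n) \sum_(y <- level j) F y + \sum_(y <- level n) Phi y <=
    Phi (base_point R).
  elim: n => [|n IH]; first by rewrite big_ord0 add0r /= big_seq1.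
  apply: le_trans IH; rewrite big_ord_recr/= -addrA lerD2l.
  by rewrite big_flatten big_map -big_split/=; apply: ler_sum.
rewrite /rsummable /summable; apply: (@le_lt_trans _ _ (Phi (base_point R))%:E);
  last exact: ltry.
apply: ge_ereal_sup => _ [A [finA _] <-].
have [N hN] : exists N, forall y, y \in finmap.enum_fset (fset_set A) ->
    exists2 j, (j < N)%N & y \in level j.
  elim: (finmap.enum_fset (fset_set A)) => [|y s [N IH]]; first by exists 0%N.
  have [n ny] := in_tree_orbit y; have [m ym] := rooted_level ny.
  exists (maxn N m.+1) => x; rewrite inE => /orP[/eqP ->|/IH[j jN xj]].
    by exists m => //; rewrite leq_max ltnS leqnn orbT.
  by exists j => //; rewrite leq_max jN.
rewrite fsbig_finite//= (eq_bigr (fun y => (F y)%:E)); last first.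
  by move=> y _; rewrite /= ger0_norm.
rewrite sumEFin lee_fin.
apply: (@le_trans _ _ (\sum_(y <- flatten [seq level j | j <- index_iota 0 N]) F y)).
  apply: sum_seq_subset => //; first exact: finmap.fset_uniq.
  move=> y /hN[j jN yj]; apply/flatten_mapP; exists j => //.
  by rewrite mem_index_iota.
rewrite big_flatten big_map/= big_mkord.
by rewrite (le_trans _ (step N))// lerDl sumr_ge0.
Qed.

Hypothesis p1 : redot p p < 1.
Hypothesis q1 : redot q q < 1.
Hypothesis vw1 : redot v v * (1 + redot w w) < 1.

Lemma tree_fun_l2 : l2 (fun y : X => tree_fun (pt y)).
Proof.
apply/l2E.
have P0 := redot_ge0 p; have Q0 := redot_ge0 q.
have V0 := redot_ge0 v; have W0 := redot_ge0 w.
have P1 := p1; have Q1 := q1; have VW1 := vw1.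
set P := redot p p in P1 P0; set Q := redot q q in Q1 Q0.
set V := redot v v in VW1 V0; set W := redot w w in VW1 W0.
have PV : 0 < 1 - P by rewrite subr_gt0.
have QV : 0 < 1 - Q by rewrite subr_gt0.
have VWV : 0 < 1 - V * (1 + W) by rewrite subr_gt0.
(* Totals of [F] over a subtree relative to its top vertex: geometric series [S1], [S2] on the rays,
   and for vertices of type v and w the solution of SZ = 1 + P S1 + W SW + V SZ, SW = 1 + Q S2 + V
   SZ. It is nonnegative because V (1 + W) < 1. *)
pose S1 := (1 - P)^-1; pose S2 := (1 - Q)^-1.
pose SZ := (1 + P * S1 + W * (1 + Q * S2)) / (1 - V * (1 + W)).
pose SW := 1 + Q * S2 + V * SZ.
have S1E : 1 + P * S1 = S1 by rewrite /S1; field; rewrite gt_eqF.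
have S2E : 1 + Q * S2 = S2 by rewrite /S2; field; rewrite gt_eqF.
have SZE : 1 + P * S1 + W * SW + V * SZ = SZ.
  rewrite /SW; have : SZ * (1 - V * (1 + W)) = 1 + P * S1 + W * (1 + Q * S2).
    by rewrite /SZ divfK// gt_eqF.
  by clear SW; move: (SZ) => Z e; lra.
have S1p : 0 <= S1 by rewrite invr_ge0 ltW.
have S2p : 0 <= S2 by rewrite invr_ge0 ltW.
have SZp : 0 <= SZ.
  apply: divr_ge0; last exact: ltW.
  by rewrite S1E S2E addr_ge0// mulr_ge0.
have SWp : 0 <= SW by rewrite /SW S2E addr_ge0// mulr_ge0.
pose K (x : R) := if x < 1 / 2 then S1 else if x < 3 / 4 then SZ
  else if x < 7 / 8 then SW else S2.
pose F (y : X) := redot (tree_fun (pt y)) (tree_fun (pt y)).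
have F0 y : 0 <= F y by exact: redot_ge0.
have K0 x : 0 <= K x by rewrite /K; do !case: ifP.
have Fc (y k : X) : parent (pt k) = pt y -> pt k != 1 / 2 ->
    F k = redot (mult (pt k)) (mult (pt k)) * F y.
  by move=> e ne; rewrite /F (tree_fun_child (in_tree_orbit y) e ne) redotZ.
have pa y' : pt (oa y') = a_fun (pt y') by [].
have paV y' : pt (oaV y') = aV_fun (pt y') by [].
have pb y' : pt (ob y') = b_fun (pt y') by [].
apply: (@level_summable F (fun y => K (pt y) * F y)) => // y.
  by rewrite mulr_ge0.
have Klo x : x < 1 / 2 -> K x = S1 by rewrite /K => ->.
have KZ x : 1 / 2 <= x -> x < 3 / 4 -> K x = SZ.
  by move=> h h'; rewrite /K ltNge h h'.
have KW x : 3 / 4 <= x -> x < 7 / 8 -> K x = SW.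
  move=> h h'; have h2 : 1 / 2 <= x by lra.
  by rewrite /K ltNge h2 ltNge h h'.
have K2 x : 7 / 8 <= x -> K x = S2.
  move=> h; have h2 : 1 / 2 <= x by lra.
  have h3 : 3 / 4 <= x by lra.
  by rewrite /K ltNge h2 ltNge h3 ltNge h.
have ca : pt y < 3 / 4 -> K (pt (oa y)) * F (oa y) = S1 * (P * F y).
  move=> h; have [h1 h2] := a_fun_child h; have h3 := a_fun_lt h.
  by rewrite (Fc y)// pa (mult_p h3) Klo.
have caV : 1 / 2 <= pt y -> pt y < 3 / 4 ->
    K (pt (oaV y)) * F (oaV y) = SW * (W * F y).
  move=> h h'; have [h1 h2] := aV_fun_child h.
  have h3 := aV_fun_ge34 h; have h4 := aV_fun_lt78 h'.
  by rewrite (Fc y)// paV (mult_w h3 h4) KW.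
have caV2 : 3 / 4 <= pt y -> K (pt (oaV y)) * F (oaV y) = S2 * (Q * F y).
  move=> h; have [|h1 h2] := @aV_fun_child (pt y); first by lra.
  have h3 := aV_fun_ge78 h.
  by rewrite (Fc y)// paV (mult_q h3) K2.
have cb : 1 / 2 < pt y -> pt y < 7 / 8 ->
    K (pt (ob y)) * F (ob y) = SZ * (V * F y).
  move=> h h'; have [h1 h2] := b_fun_child h h'.
  have h3 := ltW (b_fun_gt h); have h4 := b_fun_lt h'.
  by rewrite (Fc y)// pb (mult_v h3 h4) KZ.
have Fy := F0 y; rewrite /children.
case: (ltP (pt y) (1 / 2)) => y1.
  rewrite big_seq1 ca; last lra.
  by rewrite {1}/K y1 -[X in _ <= X * _]S1E; lra.
case: (eqVneq (pt y) (1 / 2)) => y2.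
  have y3 : pt y < 3 / 4 by lra.
  (* The root has no child through [ob]; the term V SZ of its allowance is slack. *)
  rewrite big_cons big_seq1 ca// caV// {1}/K ltNge y1 y3 /= -[X in _ <= X * _]SZE.
  have := mulr_ge0 (mulr_ge0 V0 SZp) Fy; lra.
have ygt : 1 / 2 < pt y by rewrite lt_def y2.
case: (ltP (pt y) (3 / 4)) => y3.
  rewrite !big_cons big_nil ca// caV// cb//; last lra.
  by rewrite {1}/K ltNge y1 y3 /= -[X in _ <= X * _]SZE; lra.
case: (ltP (pt y) (7 / 8)) => y4.
  rewrite big_cons big_seq1 caV2// cb//.
  by rewrite (KW _ y3 y4) /SW; lra.
rewrite big_seq1 caV2// {1}/K ltNge y1 ltNge y3 ltNge y4 /=.
by rewrite -[X in _ <= X * _]S2E; lra.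
Qed.

Lemma tree_fun_resolvent :
  laplace R (fun y : X => tree_fun (pt y)) - z *: (fun y : X => tree_fun (pt y)) =
  delta_half R.
Proof.
apply/funext => y.
transitivity (laplace R (fun y : X => tree_fun (pt y)) y - z * tree_fun (pt y)) => //.
rewrite laplaceP tree_fun_laplace; last exact: in_tree_orbit.
by rewrite /delta_half; congr ((_ : bool)%:R).
Qed.

End TreeFunction.

End Tree.

(** * Expansion of the resolvent at the bottom of the spectrum *)

Section Jets.
Variable R : realType.
Notation C := R[i].
Notation nrm := (@Normc.normc R).
Implicit Types (f g : C -> C) (s x y : C).

Lemma nrm_ge0 x : 0 <= nrm x.
Proof. by case: x => a b; exact: sqrtr_ge0. Qed.

Lemma nrmM x y : nrm (x * y) = nrm x * nrm y.
Proof. exact: Normc.normcM. Qed.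

Lemma nrmD x y : nrm (x + y) <= nrm x + nrm y.
Proof. exact: le_normcD. Qed.

Lemma nrmN x : nrm (- x) = nrm x.
Proof. exact: normcN. Qed.

Lemma nrmV x : nrm x^-1 = (nrm x)^-1.
Proof. exact: Normc.normcV. Qed.

Lemma nrm_sub x y : nrm x - nrm y <= nrm (x - y).
Proof. by rewrite lerBlDr (le_trans _ (nrmD _ _))// subrK. Qed.

Lemma nrmX x n : nrm (x ^+ n) = nrm x ^+ n.
Proof.
elim: n => [|n IH]; first by rewrite !expr0 (Normc.normc1 R).
by rewrite !exprS nrmM IH.
Qed.

Lemma Re_le_nrm x : complex.Re x <= nrm x.
Proof.
case: x => a b /=; rewrite (le_trans (ler_norm a))// -sqrtr_sqr ler_wsqrtr//.
by rewrite lerDl sqr_ge0.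
Qed.

Lemma Im_le_nrm x : `|complex.Im x| <= nrm x.
Proof.
by case: x => a b /=; rewrite -sqrtr_sqr ler_wsqrtr// lerDr sqr_ge0.
Qed.

Lemma nrm_le_mul x y (a b : R) : nrm x <= a -> nrm y <= b -> nrm (x * y) <= a * b.
Proof. by move=> h k; rewrite nrmM ler_pM// nrm_ge0. Qed.

Lemma nrm_le_add x y (a b : R) : nrm x <= a -> nrm y <= b -> nrm (x + y) <= a + b.
Proof. by move=> h k; rewrite (le_trans (nrmD _ _))// lerD. Qed.

Lemma nrm_real_le (a b : R) : - b <= a -> a <= b -> nrm a%:C%C <= b.
Proof. by move=> h k; rewrite normc_real ler_norml h. Qed.

Lemma nrm_nat n : nrm n%:R = n%:R.
Proof. by rewrite -(rmorph_nat (real_complex R)) normc_real ger0_norm. Qed.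

(** Expansion a0 + a1 s + O(s^2) at 0 in the complex plane, without differentiability, since v will
    be a root chosen separately for each s. Real coefficients make Im f equal to a1 Im s + O(s^2); r
    <= 1 lets |s|^2 be absorbed in |s|. *)
Definition jet f (a0 a1 : R) : Prop := exists K r : R, [/\ 0 <= K, 0 < r, r <= 1 &
  forall s, nrm s <= r -> nrm (f s - (a0%:C%C + a1%:C%C * s)) <= K * nrm s ^+ 2].

Lemma jet_ext f g a0 a1 : f =1 g -> jet f a0 a1 -> jet g a0 a1.
Proof.
move=> fg [K [r [K0 r0 r1 h]]]; exists K, r; split=> // s sr.
by rewrite -fg h.
Qed.

Lemma jet_coef f a0 a1 b0 b1 : a0 = b0 -> a1 = b1 -> jet f a0 a1 -> jet f b0 b1.
Proof. by move=> -> ->. Qed.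

Lemma jet_const (c : R) : jet (fun=> c%:C%C) c 0.
Proof.
exists 0, 1; split => // s _.
by rewrite (_ : 0%:C%C = 0)// mul0r addr0 subrr (Normc.normc0 R) mul0r.
Qed.

Lemma jet_id : jet id 0 1.
Proof.
exists 0, 1; split => // s _.
rewrite (_ : 0%:C%C = 0)// (_ : 1%:C%C = 1)// mul1r add0r subrr.
by rewrite (Normc.normc0 R) mul0r.
Qed.

Lemma jetD f g a0 a1 b0 b1 : jet f a0 a1 -> jet g b0 b1 ->
  jet (fun s => f s + g s) (a0 + b0) (a1 + b1).
Proof.
move=> [K [r [K0 r0 r1 h]]] [L [q [L0 q0 q1 k]]].
exists (K + L), (Num.min r q); split.
- exact: addr_ge0.
- by rewrite lt_min r0.
- by rewrite ge_min r1.
move=> s; rewrite le_min => /andP[sr sq].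
rewrite (_ : _ - _ = (f s - (a0%:C%C + a1%:C%C * s)) +
  (g s - (b0%:C%C + b1%:C%C * s))); last by rewrite !rmorphD/=; ring.
by rewrite (le_trans (nrmD _ _))// mulrDl lerD// ?h// k.
Qed.

Lemma jet_bound f a0 a1 : jet f a0 a1 -> exists K r : R, [/\ 0 <= K, 0 < r, r <= 1 &
  forall s, nrm s <= r -> nrm (f s - a0%:C%C) <= K * nrm s].
Proof.
move=> [K [r [K0 r0 r1 h]]]; exists (K + `|a1|), r; split => //.
  by rewrite addr_ge0.
move=> s sr; have s0 := nrm_ge0 s.
rewrite (_ : _ - _ = (f s - (a0%:C%C + a1%:C%C * s)) + a1%:C%C * s); last by ring.
rewrite (le_trans (nrmD _ _))// mulrDl lerD//.
  rewrite (le_trans (h s sr))// ler_wpM2l// expr2 ler_piMl//.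
  exact: le_trans r1.
by rewrite nrmM normc_real.
Qed.

Lemma jetM f g a0 a1 b0 b1 : jet f a0 a1 -> jet g b0 b1 ->
  jet (fun s => f s * g s) (a0 * b0) (a0 * b1 + a1 * b0).
Proof.
move=> jf jg; have [M [t [M0 t0 t1 m]]] := jet_bound jg.
have [K [r [K0 r0 r1 h]]] := jf; have [L [q [L0 q0 q1 k]]] := jg.
exists (K * (M + `|b0|) + `|a0| * L + `|a1| * M), (Num.min r (Num.min q t)); split.
- by rewrite !addr_ge0 ?mulr_ge0 ?addr_ge0.
- by rewrite !lt_min r0 q0.
- by rewrite ge_min r1.
move=> s; rewrite !le_min => /and3P[sr sq st].
have s0 := nrm_ge0 s; have s1 : nrm s <= 1 by exact: le_trans r1.
rewrite (_ : _ - _ = (f s - (a0%:C%C + a1%:C%C * s)) * g s +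
  a0%:C%C * (g s - (b0%:C%C + b1%:C%C * s)) +
  (a1%:C%C * s) * (g s - b0%:C%C)); last by rewrite !rmorphD/= !rmorphM/=; ring.
have gs : nrm (g s) <= M + `|b0|.
  rewrite -(subrK b0%:C%C (g s)) (le_trans (nrmD _ _))// lerD ?normc_real//.
  by rewrite (le_trans (m s st))// ler_piMr.
rewrite [leRHS]mulrDl [X in _ <= X + _]mulrDl.
apply: nrm_le_add; first apply: nrm_le_add.
- by rewrite [leRHS]mulrAC; apply: nrm_le_mul => //; exact: h.
- by rewrite -[leRHS]mulrA; apply: nrm_le_mul; [rewrite normc_real|exact: k].
- rewrite (_ : _ * _ ^+ 2 = `|a1| * nrm s * (M * nrm s)); last by ring.
  by apply: nrm_le_mul; [rewrite nrmM normc_real|exact: m].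
Qed.

Lemma jetN f a0 a1 : jet f a0 a1 -> jet (fun s => - f s) (- a0) (- a1).
Proof.
move=> [K [r [K0 r0 r1 h]]]; exists K, r; split => // s sr.
rewrite (_ : _ - _ = - (f s - (a0%:C%C + a1%:C%C * s))) ?nrmN ?h//.
by rewrite !rmorphN/=; ring.
Qed.

Lemma jetB f g a0 a1 b0 b1 : jet f a0 a1 -> jet g b0 b1 ->
  jet (fun s => f s - g s) (a0 - b0) (a1 - b1).
Proof. by move=> jf jg; apply: jetD => //; exact: jetN. Qed.

Lemma jet_scale (c : R) f a0 a1 : jet f a0 a1 ->
  jet (fun s => f (c%:C%C * s)) a0 (c * a1).
Proof.
move=> [K [r [K0 r0 r1 h]]]; have c1 : 0 < `|c| + 1 by rewrite ltr_wpDl.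
exists (K * `|c| ^+ 2), (Num.min 1 (r / (`|c| + 1))); split.
- by rewrite mulr_ge0.
- by rewrite lt_min ltr01 divr_gt0.
- by rewrite ge_min lexx.
move=> s; rewrite le_min => /andP[_]; rewrite ler_pdivlMr// => sr.
have s0 := nrm_ge0 s.
have cs : nrm (c%:C%C * s) = `|c| * nrm s by rewrite nrmM normc_real.
rewrite (_ : (c * a1)%:C%C * s = a1%:C%C * (c%:C%C * s)); last first.
  by rewrite rmorphM/=; ring.
rewrite -mulrA -exprMn -cs; apply: h.
by rewrite cs; nra.
Qed.

Lemma jet_near f a0 a1 (e : R) : jet f a0 a1 -> 0 < e -> exists r : R,
  0 < r /\ forall s, nrm s <= r -> nrm (f s - a0%:C%C) <= e.
Proof.
move=> /jet_bound[K [r [K0 r0 r1 h]]] e0.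
have K1 : 0 < K + 1 by rewrite ltr_wpDl.
exists (Num.min r (e / (K + 1))); split; first by rewrite lt_min r0 divr_gt0.
move=> s; rewrite le_min => /andP[sr]; rewrite ler_pdivlMr// => se.
by rewrite (le_trans (h s sr))//; have := nrm_ge0 s; nra.
Qed.

Lemma jetV f a0 a1 : a0 != 0 -> jet f a0 a1 ->
  jet (fun s => (f s)^-1) a0^-1 (- a1 / a0 ^+ 2).
Proof.
move=> a0n jf; have na : 0 < `|a0| by rewrite normr_gt0.
have [t [t0 m]] := jet_near jf (divr_gt0 na (ltr0n _ 2)).
have [M [t' [M0 t'0 t'1 m']]] := jet_bound jf.
have [K [r [K0 r0 r1 h]]] := jf.
have ca0 : a0%:C%C != 0 :> C by rewrite -(rmorph0 (real_complex R)) (inj_eq (@complexI R)).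
exists (K / `|a0| ^+ 2 + 2 * M ^+ 2 / `|a0| ^+ 3), (Num.min r (Num.min t t')); split.
- by rewrite addr_ge0 ?divr_ge0 ?exprn_ge0 ?mulr_ge0 ?sqr_ge0.
- by rewrite !lt_min r0 t0.
- by rewrite ge_min r1.
move=> s; rewrite !le_min => /and3P[sr st st'].
have fs : `|a0| / 2 <= nrm (f s).
  have := m s st; have := nrm_sub a0%:C%C (a0%:C%C - f s).
  rewrite subKr -[in X in _ -> X](nrmN (f s - _)) opprB normc_real; lra.
have fs0 : f s != 0.
  apply/eqP => e; move: fs; rewrite e (Normc.normc0 R); lra.
(* 1/f = 1/a0 - (f - a0)/a0^2 + (f - a0)^2/(a0^2 f) *)
rewrite (_ : _ - _ = - ((f s - (a0%:C%C + a1%:C%C * s)) * (a0%:C%C ^+ 2)^-1) +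
  (f s - a0%:C%C) ^+ 2 * ((a0%:C%C ^+ 2)^-1 * (f s)^-1)); last first.
  by rewrite !rmorphM/= !fmorphV !rmorphN/= rmorphXn/=; field; apply/andP.
have ia : nrm (a0%:C%C ^+ 2)^-1 = (`|a0| ^+ 2)^-1 by rewrite nrmV nrmX normc_real.
rewrite [leRHS]mulrDl; apply: nrm_le_add.
  by rewrite nrmN [leRHS]mulrAC; apply: nrm_le_mul; [exact: h|rewrite ia].
rewrite [leRHS](_ : _ = (M * nrm s) ^+ 2 * ((`|a0| ^+ 2)^-1 * (2 / `|a0|)));
  last by field; rewrite gt_eqF.
apply: nrm_le_mul.
  by rewrite nrmX ler_pXn2r ?nnegrE ?nrm_ge0 ?mulr_ge0 ?nrm_ge0// m'.
apply: nrm_le_mul; first by rewrite ia.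
rewrite nrmV -invf_div lef_pV2 ?posrE//; last exact: divr_gt0.
by rewrite (lt_le_trans _ fs)// divr_gt0.
Qed.

(** |P(x)| is the product of the distances from x to the n roots, so they cannot all exceed m. *)
Lemma monic_root_near (P : {poly C}) (n : nat) x (m : R) : P \is monic ->
  size P = n.+1 -> 0 <= m -> nrm P.[x] < m ^+ n ->
  exists2 y, root P y & nrm (x - y) <= m.
Proof.
move=> mP sP m0 Px; have [rs Prs] := closed_field_poly_normal P.
rewrite (monicP mP) scale1r in Prs.
have srs : size rs = n by move: sP; rewrite Prs size_prod_XsubC => -[].
have [/hasP[y yrs yx]|nh] := boolP (has (fun y => nrm (x - y) <= m) rs).
  by exists y => //; rewrite Prs root_prod_XsubC.
suff le : m ^+ n <= nrm P.[x] by move: (le_lt_trans le Px); rewrite ltxx.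
rewrite Prs -srs; move: nh; rewrite -all_predC {Prs srs}.
elim: rs => [|y l IH] /=; first by rewrite big_nil expr0 hornerC (Normc.normc1 R).
move=> /andP[]; rewrite -ltNge => yl /IH h.
by rewrite big_cons hornerM hornerXsubC nrmM exprS ler_pM ?exprn_ge0// ltW.
Qed.

Lemma cubic_root_near (b c d x : C) (m : R) : 0 <= m ->
  nrm (x ^+ 3 + b * x ^+ 2 + c * x + d) < m ^+ 3 ->
  exists2 y, y ^+ 3 + b * y ^+ 2 + c * y + d = 0 & nrm (x - y) <= m.
Proof.
move=> m0 h; pose P : {poly C} := Poly [:: d; c; b; 1].
have PE y : P.[y] = y ^+ 3 + b * y ^+ 2 + c * y + d.
  by rewrite /P horner_Poly /=; ring.
have PS : polyseq P = [:: d; c; b; 1] by rewrite (@PolyK _ 0)//= oner_neq0.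
have sP : size P = 4%N by rewrite PS.
have mP : P \is monic by rewrite monicE /lead_coef PS.
rewrite -PE in h; have [y /rootP] := monic_root_near mP sP m0 h.
by rewrite PE => ey yx; exists y.
Qed.

(** The constants bound v near 2 - sqrt 2 < 0.6 and w near 1 / sqrt 2 < 0.72, each with a margin of
    0.01. *)
Lemma sqr_mul_lt1 (x y : R) : 0 <= x -> 0 <= y -> x <= 61 / 100 -> y <= 73 / 100 ->
  x ^+ 2 * (1 + y ^+ 2) < 1.
Proof.
move=> x0 y0 x1 y1.
have : x ^+ 2 <= (61 / 100) ^+ 2 by rewrite ler_pXn2r// nnegrE; lra.
have : y ^+ 2 <= (73 / 100) ^+ 2 by rewrite ler_pXn2r// nnegrE; lra.
by have := sqr_ge0 x; have := sqr_ge0 y; nra.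
Qed.

(** * The multipliers p, q, v, w as functions of s = sqrt (- z) *)

Section BranchRatios.

Let r2 : R := Num.sqrt 2.
Let r2_sqr : r2 ^+ 2 = 2. Proof. by rewrite /r2 sqr_sqrtr. Qed.
Let r2_gt0 : 0 < r2. Proof. by rewrite sqrtr_gt0. Qed.
Let r2_gt : 7 / 5 < r2. Proof. by have := r2_sqr; have := r2_gt0; nra. Qed.
Let r2_lt : r2 < 142 / 100. Proof. by have := r2_sqr; have := r2_gt0; nra. Qed.

(** For s = sinh x, [rho s] plays the role of cosh x, and [decay s] that of exp (2 x). *)
Definition rho (s : C) : C := sqrtc (1 + s ^+ 2).

Lemma rho_sqr s : rho s ^+ 2 = 1 + s ^+ 2.
Proof. exact: sqr_sqrtc. Qed.

Lemma Re_rho_ge0 s : 0 <= complex.Re (rho s).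
Proof. by rewrite /rho; case: (1 + s ^+ 2) => a b; exact: sqrtr_ge0. Qed.

(** (rho - 1) (rho + 1) = s^2, and |rho + 1| >= 1 because Re rho >= 0. *)
Lemma jet_rho : jet rho 1 0.
Proof.
exists 1, 1; split => // s _.
rewrite (_ : 0%:C%C = 0)// (_ : 1%:C%C = 1)// mul0r addr0 mul1r -nrmX.
have : (rho s - 1) * (rho s + 1) = s ^+ 2.
  by rewrite -subr_sqr_1 rho_sqr addrAC subrr add0r.
move=> <-; rewrite nrmM ler_peMr ?nrm_ge0//.
rewrite (le_trans _ (Re_le_nrm _))//.
have := Re_rho_ge0 s; case: (rho s) => a b /=; lra.
Qed.

(* The decaying root of x + 1/x = 2 + 4 s^2, s = sqrt (- z), is 1 / decay s. *)
Definition decay (s : C) : C := (rho s + s) ^+ 2.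

Lemma decayM s : decay s * (rho s - s) ^+ 2 = 1.
Proof.
rewrite /decay -exprMn (_ : _ * _ = rho s ^+ 2 - s ^+ 2); last by ring.
by rewrite rho_sqr addrK expr1n.
Qed.

Lemma decay_neq0 s : decay s != 0.
Proof. by apply/eqP => e; have := decayM s; rewrite e mul0r => /eqP; rewrite eq_sym oner_eq0. Qed.

Lemma decayV s : (decay s)^-1 = (rho s - s) ^+ 2.
Proof. by apply: (mulfI (decay_neq0 s)); rewrite mulfV ?decay_neq0// decayM. Qed.

Lemma decay_sum s : decay s + (decay s)^-1 = 2 + 4 * s ^+ 2.
Proof.
rewrite decayV /decay (_ : _ + _ = 2 * rho s ^+ 2 + 2 * s ^+ 2); last by ring.
by rewrite rho_sqr; ring.
Qed.

Lemma jet_decay : jet decay 1 2.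
Proof.
have := jetM (jetD jet_rho jet_id) (jetD jet_rho jet_id).
move/(jet_coef (b0 := 1) (b1 := 2)) => /(_ ltac:(ring) ltac:(ring)).
by apply: jet_ext => s; rewrite /decay expr2.
Qed.

(** The claim amounts to |rho - s| < |rho + s|, that is, [redot (rho s) s > 0]. Write rho = a + i b
    and s = c + i d. From rho^2 = 1 + s^2 come ab = cd, so a (ac + bd) = c (a^2 + d^2), and a > 0,
    as |s| < 1 makes 1 + c^2 - d^2 positive. *)
Lemma decay_gt1 s : 0 < complex.Re s -> nrm s < 1 ->
  redot (decay s)^-1 (decay s)^-1 < 1.
Proof.
move=> c0 s1; have dot : 0 < redot (rho s) s.
  have a0 := Re_rho_ge0 s; have := rho_sqr s.
  have : nrm s ^+ 2 < 1 by rewrite expr_lt1 ?nrm_ge0.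
  rewrite -redot_normc; move: (rho s) a0 => r; move: s c0 {s1} r.
  move=> [c d] c0 [a b]; rewrite /redot /= in c0 * => a0 n1.
  rewrite !expr2 => /eqP; rewrite eq_complex /=.
  move=> /andP[/eqP h1 /eqP h2].
  have ab : a * b = c * d by lra.
  have a1 : 0 < a.
    rewrite lt_def a0 andbT; apply/eqP => e; move: h1; rewrite e; nra.
  have : 0 < a * (a * c + b * d).
    rewrite (_ : _ * _ = c * (a ^+ 2 + d ^+ 2)).
      by rewrite mulr_gt0// ltr_pwDl ?sqr_ge0// exprn_gt0.
    by rewrite mulrDr [a * (b * d)]mulrA ab; ring.
  by rewrite pmulr_rgt0.
rewrite redot_normc decayV nrmX.
have h1 : nrm (rho s - s) ^+ 2 * nrm (rho s + s) ^+ 2 = 1.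
  by rewrite -!nrmX -nrmM mulrC decayM (Normc.normc1 R).
have h2 : nrm (rho s - s) ^+ 2 < nrm (rho s + s) ^+ 2.
  rewrite -!redot_normc; move: dot; rewrite /redot.
  by case: (rho s) => a b; case: (s) => c d /=; lra.
have h3 := sqr_ge0 (nrm (rho s - s)).
move: h1 h2 h3; move: (_ ^+ 2) => x; move: (_ ^+ 2) => y.
rewrite expr2; nra.
Qed.

(** [P] and [Q] are 1/p and 1/q. For z = - s^2 the equation for q has right-hand side 2 + 2 s^2 = 2
    + 4 (s / sqrt 2)^2, hence the rescaling in [Q]. *)
Let P := decay.
Let Q s := decay ((r2^-1)%:C%C * s).

Let jet_Q : jet Q 1 r2.
Proof.
have := jet_scale (r2^-1) jet_decay.
rewrite (_ : r2^-1 * 2 = r2)//.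
by rewrite -r2_sqr expr2 mulKf// gt_eqF.
Qed.

(** At s = 0 the cubic is (x - 1) (x^2 - 4 x + 2). Its root 1 gives w = 1, and 2 + sqrt 2 exceeds 1,
    so only 2 - sqrt 2 satisfies v^2 (1 + w^2) < 1. Implicit differentiation there gives [v1] = - 2
    sqrt 2 / (4 - 2 sqrt 2) = - (1 + sqrt 2). *)
Let v0 : R := 2 - r2.
Let v1 : R := - (1 + r2).
Let vhat (s : C) : C := v0%:C%C + v1%:C%C * s.

Let jet_vhat : jet vhat v0 v1.
Proof. by exists 0, 1; split => // s _; rewrite subrr (Normc.normc0 R) mul0r. Qed.

(* Eliminating w between w (2 Q - v) = 1 and v (2 + P - w - v) = 1. *)
Let cubic (s x : C) : C := x * (2 + P s - x) * (2 * Q s - x) - 2 * Q s.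

(** [v0] and [v1] are made for this: both coefficients are multiples of r2^2 - 2, so [vhat] solves
    the cubic up to O(s^2). *)
Let jet_cubic : jet (fun s => cubic s (vhat s)) 0 0.
Proof.
have jc := jetB (jetM (jetM jet_vhat (jetB (jetD (jet_const 2) jet_decay) jet_vhat))
  (jetB (jetM (jet_const 2) jet_Q) jet_vhat)) (jetM (jet_const 2) jet_Q).
have E0 : v0 * (2 + 1 - v0) * (2 * 1 - v0) - 2 * 1 = 0.
  have -> : v0 * (2 + 1 - v0) * (2 * 1 - v0) - 2 * 1 =
    (r2 ^+ 2 - 2) * (1 - r2) by rewrite /v0; ring.
  by rewrite r2_sqr subrr mul0r.
rewrite E0 in jc.
set a1 := (X in jet _ _ X) in jc.
have E1 : a1 = 0.
  have -> : a1 = (r2 ^+ 2 - 2) * - (1 + 5 * r2) by rewrite /a1 /v0 /v1; ring.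
  by rewrite r2_sqr subrr mul0r.
rewrite E1 in jc; apply: jet_ext jc => s.
by rewrite /cubic /P (_ : 2%:C%C = 2 :> C) ?rmorph_nat.
Qed.

Let cubicE s x : cubic s x =
  x ^+ 3 + - (2 + P s + 2 * Q s) * x ^+ 2 + (2 + P s) * (2 * Q s) * x + - (2 * Q s).
Proof. by rewrite /cubic; ring. Qed.

Let cubic_diff s x y : cubic s x - cubic s y = (x - y) *
  (x ^+ 2 + x * y + y ^+ 2 - (2 + P s + 2 * Q s) * (x + y) + (2 + P s) * (2 * Q s)).
Proof. by rewrite /cubic; ring. Qed.

(* The derivative of the cubic at the base point is 4 - 2 sqrt 2. *)
Let cubic_slope s (a b c d e : C) (m : R) : m = 1 / 100 ->
  a = v0%:C%C + b -> c = v0%:C%C + d -> P s = 1 + e ->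
  nrm b <= m -> nrm d <= m -> nrm e <= m -> nrm (Q s - 1) <= m ->
  1 / 2 <= nrm (a ^+ 2 + a * c + c ^+ 2 - (2 + P s + 2 * Q s) * (a + c) +
    (2 + P s) * (2 * Q s)).
Proof.
move=> mE -> -> -> nb nd ne; rewrite -[in X in _ -> X](subrK 1 (Q s)).
move: (Q s - 1) => q nq.
set D := _ + _ * _.
(* All terms of [D] that vanish with the perturbations. They add up to less than 0.26, while 4 - 2
   sqrt 2 > 1.16. *)
pose rest : C := 3 * v0%:C%C * (b + d) + (b * b + b * d + d * d) - 5 * (b + d)
  - (e + 2 * q) * (2 * v0%:C%C + (b + d)) + (6 * q + 2 * e + 2 * (e * q)).
have DE : D = (4 - 2 * r2)%:C%C + rest.
  have e2 : (r2%:C%C) ^+ 2 = 2 :> C.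
    by rewrite -rmorphXn/= r2_sqr rmorph_nat.
  rewrite (_ : (4 - 2 * r2)%:C%C = 4 - 2 * r2%:C%C); last first.
    by rewrite rmorphB/= rmorphM/= !rmorph_nat.
  rewrite (_ : 4 = 10 - 3 * 2 :> C); last by ring.
  rewrite -[in X in 10 - 3 * X]e2 /D /rest /v0 rmorphB/= rmorph_nat; ring: e2.
have m1 : m <= 1 by rewrite mE; lra.
have m0 : 0 <= m by rewrite mE; lra.
have n2 : nrm 2 <= 2 by rewrite nrm_nat.
have n3 : nrm 3 <= 3 by rewrite nrm_nat.
have n5 : nrm 5 <= 5 by rewrite nrm_nat.
have n6 : nrm 6 <= 6 by rewrite nrm_nat.
have nv : nrm v0%:C%C <= 6 / 10.
  by apply: nrm_real_le; rewrite /v0; have := r2_gt; have := r2_lt; lra.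
have nbd := nrm_le_add nb nd.
have t1 := nrm_le_mul (nrm_le_mul n3 nv) nbd.
have t2 := nrm_le_add (nrm_le_add (nrm_le_mul nb nb) (nrm_le_mul nb nd)) (nrm_le_mul nd nd).
have t3 := nrm_le_mul n5 nbd.
have t4 := nrm_le_mul (nrm_le_add ne (nrm_le_mul n2 nq))
  (nrm_le_add (nrm_le_mul n2 nv) nbd).
have t5 := nrm_le_add (nrm_le_add (nrm_le_mul n6 nq) (nrm_le_mul n2 ne))
  (nrm_le_mul n2 (nrm_le_mul ne nq)).
rewrite -(nrmN (5 * (b + d))) in t3; rewrite -(nrmN (_ * _)) in t4.
have := nrm_le_add (nrm_le_add (nrm_le_add (nrm_le_add t1 t2) t3) t4) t5.
rewrite -/rest => nrest.
have := nrm_sub (4 - 2 * r2)%:C%C (- rest); rewrite opprK -DE nrmN normc_real.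
have := ler_norm (4 - 2 * r2); have := r2_lt; move: nrest; rewrite mE; lra.
Qed.

(** [cubic_root_near] yields a root within 1/200 of [vhat s], hence within 1/100 of [v0]. There the
    divided difference of the cubic is at least 1/2 by [cubic_slope], so the residual O(s^2) at
    [vhat s] bounds the distance to the root. The branch is then chosen pointwise. *)
Lemma cubic_branch : exists vf : C -> C, jet vf v0 v1 /\
  exists r : R, 0 < r /\ forall s, nrm s <= r -> cubic s (vf s) = 0.
Proof.
pose m : R := 1 / 100; pose m' : R := 1 / 200.
have m0 : 0 < m by rewrite /m; lra.
have m'0 : 0 < m' by rewrite /m'; lra.
have [r1 [r10 h1]] := jet_near jet_vhat m'0.
have [r2' [r20 h2]] := jet_near jet_decay m0.
have [r3 [r30 h3]] := jet_near jet_Q m0.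
have m30 : 0 < m' ^+ 3 / 2 by rewrite divr_gt0// exprn_gt0.
have [r4 [r40 h4]] := jet_near jet_cubic m30.
have [K [r5 [K0 r50 r51 h5]]] := jet_cubic.
pose r := Num.min (Num.min r1 r2') (Num.min (Num.min r3 r4) r5).
have r0 : 0 < r by rewrite !lt_min r10 r20 r30 r40 r50.
have root s : nrm s <= r -> exists y, cubic s y = 0 /\ nrm (y - vhat s) <= 2 * K * nrm s ^+ 2.
  rewrite !le_min => /andP[/andP[s1 s2] /andP[/andP[s3 s4] s5]].
  have small : nrm (cubic s (vhat s)) < m' ^+ 3.
    have := h4 s s4; rewrite (_ : 0%:C%C = 0)// subr0 => le.
    by rewrite (le_lt_trans le)// ltr_pdivrMr// ltr_pMr ?exprn_gt0//; lra.
  rewrite cubicE in small.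
  have [y y0 yn] := cubic_root_near (ltW m'0) small.
  rewrite -cubicE in y0; exists y; split => //.
  have vn := h1 s s1.
  have yv : nrm (y - v0%:C%C) <= m.
    rewrite (_ : y - _ = - (vhat s - y) + (vhat s - v0%:C%C)); last by ring.
    rewrite (le_trans (nrmD _ _))// nrmN.
    by move: yn vn; rewrite /m /m'; lra.
  have vn' : nrm (vhat s - v0%:C%C) <= m by move: vn; rewrite /m /m'; lra.
  have slope := @cubic_slope s y (y - v0%:C%C) (vhat s) (vhat s - v0%:C%C)
    (P s - 1) m erefl (esym (subrKC _ _)) (esym (subrKC _ _)) (esym (subrKC _ _))
    yv vn' (h2 s s2) (h3 s s3).
  have := cubic_diff s y (vhat s); rewrite y0 sub0r => /(f_equal nrm).
  rewrite nrmN nrmM => e.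
  have := h5 s s5; rewrite (_ : 0%:C%C = 0)// mul0r addr0 subr0 e => le.
  have := nrm_ge0 (y - vhat s); move: le slope.
  by move: (nrm (_ + _)) (nrm (_ - _)) => A B; nra.
pose vf s := xget 0 [set y | cubic s y = 0 /\ nrm (y - vhat s) <= 2 * K * nrm s ^+ 2].
have vfP s : nrm s <= r -> cubic s (vf s) = 0 /\ nrm (vf s - vhat s) <= 2 * K * nrm s ^+ 2.
  by move=> /root[y yP]; rewrite /vf; case: xgetP => [x _ //|/(_ y)].
exists vf; split; last by exists r; split => // s /vfP[].
exists (2 * K), r; split => //; first by rewrite mulr_ge0.
- by rewrite !ge_min r51 !orbT.
- by move=> s /vfP[].
Qed.

Lemma resolvent_parameters : exists kappa K r : R,
  [/\ 0 < kappa, 0 <= K, 0 < r & forall s, 0 < complex.Re s -> nrm s <= r ->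
   exists p q w v G : C,
   [/\ [/\ p != 0, q != 0, redot p p < 1, redot q q < 1 &
           redot v v * (1 + redot w w) < 1],
      p + p^-1 = 2 - 4 * - s ^+ 2, q + q^-1 = 2 - 2 * - s ^+ 2,
      [/\ w * (2 / q - v) = 1, v * (2 + p^-1 - w - v) = 1 & G * (p^-1 - w) = 4] &
      `|complex.Im G + kappa * complex.Im s| <= K * nrm s ^+ 2]].
Proof.
have [vf [jv [r1 [r10 vE]]]] := cubic_branch.
have r2V : r2^-1 < 72 / 100.
  by rewrite -[X in _ < X]invf_div ltf_pV2 ?posrE//; have := r2_gt; lra.
have r2V0 : 1 / 2 < r2^-1.
  by rewrite -[X in X < _]invf_div ltf_pV2 ?posrE//; have := r2_lt; lra.
have r2n : r2 != 0 by rewrite gt_eqF.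
have j2Q := jetB (jetM (jet_const 2) jet_Q) jv.
have jw : jet (fun s => (2 * Q s - vf s)^-1) r2^-1 (- (1 + 3 * r2) / 2).
  have b0n : 2 * 1 - v0 != 0 by rewrite /v0 (_ : _ - _ = r2)//; ring.
  have := jetV b0n j2Q; have E : 2 * 1 - v0 = r2 by rewrite /v0; ring.
  rewrite E r2_sqr; move/(jet_coef (b0 := r2^-1) (b1 := - (1 + 3 * r2) / 2)).
  move=> /(_ erefl) h; apply: jet_ext (h _) => [s|]; first by rewrite rmorph_nat.
  by rewrite /v1; congr (_ / _); ring.
have jd := jetB jet_decay jw.
set a0 := (X in jet _ X _) in jd; set a1 := (X in jet _ _ X) in jd.
have a0p : 28 / 100 < a0 by rewrite /a0; lra.
have a0n : a0 != 0 by rewrite gt_eqF//; lra.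
have a1p : 0 < a1 by rewrite /a1; have := r2_gt0; lra.
have jG := jetM (jet_const 4) (jetV a0n jd).
have [K [r3 [K0 r30 _ hG]]] := jG.
have e0 : 0 < 1 / 100 :> R by lra.
have [r4 [r40 hv]] := jet_near jv e0.
have [r5 [r50 hw]] := jet_near jw e0.
have [r6 [r60 hd]] := jet_near jd e0.
(* G = 4 / (P - w) and P - w = a0 + a1 s + O(s^2), so the slope of G is - 4 a1 / a0^2. The bound 1/2
   on |s| serves [decay_gt1]. *)
exists (4 * (a1 / a0 ^+ 2)), K, (Num.min (Num.min (Num.min r1 r3) (Num.min r4 r5))
  (Num.min r6 (1 / 2))).
have a2 : 0 < a0 ^+ 2 by rewrite exprn_gt0//; lra.
split => //.
- by rewrite mulr_gt0// divr_gt0.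
- by rewrite !lt_min r10 r30 r40 r50 r60; lra.
move=> s s0; rewrite !le_min.
move=> /andP[/andP[/andP[s1 s3] /andP[s4 s5]] /andP[s6 s7]].
set v := vf s; set w := (2 * Q s - v)^-1; set G := 4 * (P s - w)^-1.
have nw : nrm (w - r2^-1%:C%C) <= 1 / 100 by exact: hw.
have nv : nrm (v - v0%:C%C) <= 1 / 100 by exact: hv.
have wn : w != 0.
  apply/eqP => e; move: nw; rewrite e sub0r nrmN normc_real.
  by have := ler_norm r2^-1; lra.
have w1 : w * (2 * Q s - v) = 1.
  rewrite /w mulVf//; apply: contra_neq wn => e.
  by rewrite /w e invr0.
have dn : P s - w != 0.
  apply/eqP => e; have := hd s s6; rewrite -/P -/v -/w e sub0r nrmN normc_real.
  by have := ler_norm a0; lra.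
have v2 : v * (2 + P s - w - v) = 1.
  have := vE s s1; rewrite /cubic -/v => /eqP; rewrite subr_eq0 => /eqP e.
  (* The cubic equation multiplied by [w], with w (2 Q - v) = 1. *)
  have e2 : v * (2 + P s - v) = 2 * Q s * w.
    by rewrite -e -mulrA [_ * w]mulrC w1 mulr1.
  rewrite (_ : _ * _ = v * (2 + P s - v) - v * w); last by ring.
  by rewrite e2 -mulrBl mulrC w1.
exists (P s)^-1, (Q s)^-1, w, v, G; rewrite !invrK; split.
- split; rewrite ?invr_eq0 ?decay_neq0//.
  + by apply: decay_gt1 => //; lra.
  + have i0 : 0 < r2^-1 by rewrite invr_gt0.
    apply: decay_gt1.
      rewrite (_ : complex.Re _ = r2^-1 * complex.Re s) ?mulr_gt0//.
      by case: (s) => c d /=; ring.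
    rewrite nrmM normc_real ger0_norm ?(ltW i0)//.
    by have := nrm_ge0 s; nra.
  + rewrite !redot_normc.
    apply: sqr_mul_lt1; rewrite ?nrm_ge0//.
      have := nrm_sub v v0%:C%C; rewrite normc_real ger0_norm.
        by have := r2_gt; rewrite /v0 in nv *; lra.
      by rewrite /v0; have := r2_lt; lra.
    have := nrm_sub w r2^-1%:C%C.
    by rewrite normc_real ger0_norm; lra.
- by rewrite addrC decay_sum; ring.
- rewrite addrC decay_sum exprMn -rmorphXn/= exprVn r2_sqr fmorphV rmorph_nat.
  by field.
- by split => //; rewrite /G mulfVK.
have := hG s s3; rewrite rmorph_nat -/P -/v -/w -/G; apply: le_trans.
apply: le_trans (Im_le_nrm _); rewrite le_eqVlt; apply/orP; left; apply/eqP.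
congr `|_|; case: (G) => g1 g2; case: (s) => c d /=.
by field; apply/eqP => e; move: a0n; rewrite e eqxx.
Qed.

End BranchRatios.

End Jets.

(** * Stieltjes inversion *)

Section RealAnalysis.
Variable R : realType.
Implicit Types (F dF : R -> R).

Lemma is_derive_ge0_le F dF (a b : R) : a <= b ->
  (forall x : R, is_derive x 1 F (dF x)) -> (forall x, a < x -> x < b -> 0 <= dF x) ->
  F a <= F b.
Proof.
rewrite le_eqVlt => /orP[/eqP -> //|ab] DF pos.
have cF : {within `[a, b], continuous F}.
  by apply: derivable_within_continuous => x _; exact: (@ex_derive _ _ _ _ _ _ _ (DF x)).
have [c] := MVT ab (fun x _ => DF x) cF; rewrite in_itv/= => /andP[ac cb] e.
by rewrite -subr_ge0 e mulr_ge0 ?pos// subr_ge0 ltW.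
Qed.

(** Takes the place of integrating the estimate on the derivatives: H - (F - G) and H + (F - G) are
    both nondecreasing. *)
Lemma is_derive_dist_le F G H dF dG dH (a b : R) : a <= b ->
  (forall x : R, is_derive x 1 F (dF x)) -> (forall x : R, is_derive x 1 G (dG x)) ->
  (forall x : R, is_derive x 1 H (dH x)) ->
  (forall x, a < x -> x < b -> `|dF x - dG x| <= dH x) ->
  `|F b - F a - (G b - G a)| <= H b - H a.
Proof.
move=> ab DF DG DH h.
have D1 (x : R) : is_derive x 1 (H - (F - G)) (dH x - (dF x - dG x)).
  exact: is_deriveB.
have D2 (x : R) : is_derive x 1 (H + (F - G)) (dH x + (dF x - dG x)).
  exact: is_deriveD.
have := is_derive_ge0_le ab D1; have := is_derive_ge0_le ab D2.
rewrite !fctE => h2 h1; rewrite ler_norml; apply/andP; split.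
- suff : H a + (F a - G a) <= H b + (F b - G b) by lra.
  by apply: h2 => x ax xb; have := h x ax xb; rewrite ler_norml; lra.
- suff : H a - (F a - G a) <= H b - (F b - G b) by lra.
  by apply: h1 => x ax xb; have := h x ax xb; rewrite ler_norml; lra.
Qed.

(** pi / 2 - atan y = atan (1 / y) <= 1 / y. *)
Lemma atan_ge (y : R) : 0 < y -> pi / 2 - y^-1 <= atan y.
Proof.
move=> y0; set u := atan y.
have u0 : 0 < u by rewrite /u -[X in X < _]atan0 lt_atan.
have u1 := atan_ltpi2 y; rewrite -/u in u1.
have tu : tan (pi / 2 - u) = y^-1.
  rewrite /tan sinB cosB sin_pihalf cos_pihalf !mul0r !mul1r subr0 add0r.
  by rewrite -[RHS](f_equal GRing.inv (atanK y)) -/u /tan invf_div.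
have -> : pi / 2 - y^-1 = u + (atan y^-1 - y^-1).
  rewrite -tu tanK; first by ring.
  by rewrite in_itv/=; apply/andP; split; lra.
have yV : 0 <= y^-1 by rewrite invr_ge0 ltW.
have D (x : R) : is_derive x 1 ((id : R -> R) - atan) (1 - (1 + x ^+ 2)^-1).
  exact: is_deriveB.
have := is_derive_ge0_le yV D; rewrite !fctE atan0 subr0 => h.
suff : 0 <= y^-1 - atan y^-1 by lra.
apply: h => x x0 _; rewrite subr_ge0 invf_le1 ?ltr_pwDl ?sqr_ge0//.
by rewrite lerDl sqr_ge0.
Qed.

Lemma is_derive_square (x : R) : is_derive x 1 (fun y : R => y ^+ 2) (2 * x).
Proof.
rewrite (_ : (fun y => _) = (id : R -> R) ^+ 2); last by apply/funext => y; rewrite exprfctE.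
by apply: is_derive_eq; rewrite /GRing.scale /= mulr1 expr1.
Qed.

Lemma is_derive_cubic (A B C x : R) :
  is_derive x 1 (fun y : R => A * y ^+ 3 + B * y ^+ 2 + C * y)
    (3 * A * x ^+ 2 + 2 * B * x + C).
Proof.
rewrite (_ : (fun y => _) = A \*: ((id : R -> R) ^+ 3) + B \*: ((id : R -> R) ^+ 2)
  + C \*: (id : R -> R)); last by apply/funext => y; rewrite !exprfctE.
apply: (is_derive_eq (is_deriveD (is_deriveD
  (is_deriveZ A (is_deriveX 3 (is_derive_id x 1)))
  (is_deriveZ B (is_deriveX 2 (is_derive_id x 1)))) (is_deriveZ C (is_derive_id x 1)))).
by rewrite /GRing.scale /= !mulr1; ring.
Qed.

Section AtanSum.
Variables (n : nat) (a c : nat -> R) (e : R).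

Definition atan_sum (t : R) : R := \sum_(k < n) a k * atan ((t - c k) / e).

(** Imaginary part at t + i e of the Stieltjes transform of the measure with masses [a k] at [c k];
    [atan_sum] is a primitive. *)
Definition poisson_sum (t : R) : R :=
  \sum_(k < n) a k * (e / ((t - c k) ^+ 2 + e ^+ 2)).

Lemma is_derive_atan_sum (t : R) : 0 < e -> is_derive t 1 atan_sum (poisson_sum t).
Proof.
move=> e0; pose h (k : 'I_n) : R -> R :=
  a k \*: (atan \o (e^-1 \*: ((id : R -> R) - cst (c k)))).
rewrite (_ : atan_sum = \sum_(k < n) h k); last first.
  apply/funext => s; rewrite fct_sumE; apply: eq_bigr => k _.
  transitivity (a k * atan (e^-1 * (s - c k))); last by [].
  by rewrite [e^-1 * _]mulrC.
apply: is_derive_sum => k; rewrite /h; apply: is_derive_eq.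
rewrite /GRing.scale /= subr0 mulr1; congr (_ * _).
transitivity ((1 + (e^-1 * (t - c k)) ^+ 2)^-1 / e); first by [].
have p : 0 < (t - c k) ^+ 2 + e ^+ 2 by rewrite ltr_wpDl ?sqr_ge0// exprn_gt0.
have p' : 0 < 1 + (e^-1 * (t - c k)) ^+ 2 by rewrite ltr_pwDl ?sqr_ge0.
by field; rewrite !gt_eqF.
Qed.

Variables (kappa L : R).
Hypothesis e0 : 0 < e.

(** The substitution t = y^2 avoids the non-differentiability of sqrt t at 0: the comparison
    function becomes the polynomial (2/3) kappa y^3. *)
Lemma atan_sum_sqr_le y : 0 <= y ->
  (forall t, 0 <= t -> t <= y ^+ 2 -> `|poisson_sum t - kappa * Num.sqrt t| <= L) ->
  `|atan_sum (y ^+ 2) - atan_sum 0 - 2 / 3 * kappa * y ^+ 3| <= L * y ^+ 2.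
Proof.
move=> y0 hL.
have D (s : R) : is_derive s 1 (atan_sum \o (fun y : R => y ^+ 2)) (poisson_sum (s ^+ 2) * (2 * s)).
  exact: (@is_derive1_comp _ _ _ _ _ _ (is_derive_atan_sum _ e0) (is_derive_square s)).
have hS s : 0 < s -> s < y -> `|poisson_sum (s ^+ 2) - kappa * s| <= L.
  move=> s0 sy; have := hL (s ^+ 2); rewrite sqr_ge0 sqrtr_sqr (ger0_norm (ltW s0)).
  by apply => //; rewrite ler_pXn2r ?nnegrE// ltW.
have QG s := is_derive_cubic (2 / 3 * kappa) 0 0 s.
have QH s := is_derive_cubic 0 L 0 s.
have := is_derive_dist_le y0 D QG QH.
rewrite /= !expr0n /= !mulr0 !mul0r !addr0 add0r !subr0; apply => s s0 sy.
rewrite (_ : _ - _ = 2 * s * (poisson_sum (s ^+ 2) - kappa * s)); last by field.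
rewrite normrM ger0_norm ?mulr_ge0 ?(ltW s0)//.
have := hS s s0 sy; nra.
Qed.

Lemma atan_sum_neg_le x : 0 <= x ->
  (forall t, - x <= t -> t <= 0 -> `|poisson_sum t| <= L) ->
  `|atan_sum 0 - atan_sum (- x)| <= L * x.
Proof.
move=> x0 hL; have nx : - x <= 0 by rewrite oppr_le0.
have QG s := is_derive_cubic 0 0 0 s.
have QH s := is_derive_cubic 0 0 L s.
have := is_derive_dist_le nx (fun s => is_derive_atan_sum s e0) QG QH.
rewrite !mulr0 !mul0r ?addr0 ?add0r ?mulrN ?opprK ?oppr0 ?addr0 ?add0r.
apply => s s0 sy.
by rewrite ?mulr0 !mul0r ?addr0 ?add0r subr0 hL// ltW.
Qed.

End AtanSum.
Lemma atan_sum_diff n (a c : nat -> R) e x :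
  atan_sum n a c e x - atan_sum n a c e (- x) =
  \sum_(k < n) a k * (atan ((x - c k) / e) - atan ((- x - c k) / e)).
Proof.
by rewrite /atan_sum -sumrB; apply: eq_bigr => k _; rewrite mulrBr.
Qed.

(* If y^2 = s +- s^2 then y^3 = s^(3/2) (1 +- s)^(3/2). *)
Lemma sqrt_cube_perturb (s : R) : 0 < s -> s <= 1 / 2 -> exists yp ym : R,
  [/\ 0 <= yp /\ 0 <= ym, yp ^+ 2 = s + s ^+ 2 /\ ym ^+ 2 = s - s ^+ 2,
      yp ^+ 3 <= Num.sqrt s ^+ 3 + 3 * s ^+ 2 &
      Num.sqrt s ^+ 3 - 2 * s ^+ 2 <= ym ^+ 3].
Proof.
move=> sp s12; have s2s : s ^+ 2 <= s / 2 by rewrite expr2; nra.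
pose q := Num.sqrt s.
have q0 : 0 <= q by exact: sqrtr_ge0.
have q2 : q ^+ 2 = s by rewrite sqr_sqrtr// ltW.
have q1 : q <= 1 by rewrite -(ler_pXn2r (n := 2)) ?nnegrE// q2 expr1n; lra.
have q30 : 0 <= q ^+ 3 by rewrite exprn_ge0.
have q3s : q ^+ 3 * s <= s ^+ 2.
  rewrite -q2; have -> : q ^+ 3 * q ^+ 2 = (q ^+ 2) ^+ 2 * q by ring.
  by rewrite ler_piMr ?sqr_ge0.
pose rp := Num.sqrt (1 + s).
have rp0 : 0 <= rp by exact: sqrtr_ge0.
have rp2 : rp ^+ 2 = 1 + s by rewrite sqr_sqrtr//; lra.
have rp1 : rp <= 1 + s.
  rewrite -(ler_pXn2r (n := 2)) ?nnegrE//; last lra.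
  by rewrite rp2 sqrrD expr1n mul1r; have := sqr_ge0 s; lra.
pose rm := Num.sqrt (1 - s).
have rm0 : 0 <= rm by exact: sqrtr_ge0.
have rm2 : rm ^+ 2 = 1 - s by rewrite sqr_sqrtr//; lra.
have rm1 : 1 - s <= rm.
  rewrite -rm2 expr2 ler_piMr//.
  by rewrite -(ler_pXn2r (n := 2)) ?nnegrE// rm2 expr1n; lra.
have yp2 : (q * rp) ^+ 2 = s + s ^+ 2 by rewrite exprMn q2 rp2; ring.
have ym2 : (q * rm) ^+ 2 = s - s ^+ 2 by rewrite exprMn q2 rm2; ring.
have yp3 : (q * rp) ^+ 3 <= q ^+ 3 + 3 * s ^+ 2.
  have -> : (q * rp) ^+ 3 = q ^+ 3 * ((1 + s) * rp) by rewrite -rp2; ring.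
  have : (1 + s) * rp <= 1 + 3 * s.
    have : (1 + s) * rp <= (1 + s) * (1 + s) by rewrite ler_wpM2l//; lra.
    by rewrite expr2 in s2s; lra.
  by move/(ler_wpM2l q30); lra.
have ym3 : q ^+ 3 - 2 * s ^+ 2 <= (q * rm) ^+ 3.
  have -> : (q * rm) ^+ 3 = q ^+ 3 * ((1 - s) * rm) by rewrite -rm2; ring.
  have : 1 - 2 * s <= (1 - s) * rm.
    have : (1 - s) * (1 - s) <= (1 - s) * rm by rewrite ler_wpM2l//; lra.
    by have := sqr_ge0 s; rewrite expr2; lra.
  by move/(ler_wpM2l q30); lra.
by exists (q * rp), (q * rm); split=> //; split; rewrite // mulr_ge0.
Qed.

Lemma stieltjes_asymptotics (kappa K s0 : R) (N : R -> R) :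
  0 < kappa -> 0 <= K -> 0 < s0 ->
  (forall e : R, 0 < e -> e <= 1 -> exists n (a c : nat -> R),
    [/\ forall k, 0 <= a k, \sum_(k < n) a k = 1,
      forall k, c k + e ^+ 4 < 0 -> a k = 0,
      forall s, exists b : nat -> R, [/\ N s = \sum_(k < n) b k,
        forall k, 0 <= b k <= a k, forall k, s < c k -> b k = 0 &
        forall k, c k + e ^+ 4 <= s -> b k = a k] &
      forall t : R, `|t| <= s0 -> e <= s0 ->
        `|poisson_sum n a c (e ^+ 2) t - kappa * Num.sqrt t| <= K * (`|t| + e)]) ->
  exists C : R, 0 < C /\ exists M s1 : R, 0 < s1 /\
    forall s, 0 < s -> s <= s1 -> `|N s - C * Num.sqrt s ^+ 3| <= M * s ^+ 2.
Proof.
move=> kp K0 s00 H; have pi0 := pi_gt0 R.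
exists (2 / 3 * kappa / pi); split; first by rewrite divr_gt0 ?mulr_gt0.
exists ((2 * kappa + 12 * K + 2) / pi), (Num.min (1 / 2) (s0 / 2)).
split; first by rewrite lt_min !divr_gt0.
move=> s sp; rewrite le_min => /andP[s12 ss0].
have s2p : 0 < s ^+ 2 by rewrite exprn_gt0.
have s2s : s ^+ 2 <= s / 2 by rewrite expr2; nra.
have s21 : s ^+ 2 <= 1 by lra.
(* Applied at s^2: the Poisson kernels have width s^4, called [e] below, and the cells have length
   s^8, called [h]. *)
have [n [a [c [a0 a1 aneg cells approx]]]] := H _ s2p s21.
have [b [bN ba bout bin]] := cells s.
set e := (s ^+ 2) ^+ 2 in approx *.
have e0 : 0 < e by rewrite exprn_gt0.
set h := (s ^+ 2) ^+ 4 in aneg bin.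
have h0 : 0 <= h by rewrite exprn_ge0// ltW.
have hs : h <= s ^+ 2 / 2.
  have e1 : e <= s ^+ 2 / 2 by rewrite /e expr2; nra.
  have -> : h = e * e by rewrite /h /e; ring.
  by nra.
have N1 : N s <= 1.
  by rewrite bN -a1; apply: ler_sum => k _; have /andP[] := ba k.
have N0 : 0 <= N s by rewrite bN; apply: sumr_ge0 => k _; have /andP[] := ba k.
pose Psi := atan_sum n a c e.
(* On the window the error density is at most 3 K s, and each half has length y^2 <= 2 s; the two
   halves give 12 K s^2. *)
have main y : 0 <= y -> y ^+ 2 <= s + s ^+ 2 ->
    `|Psi (y ^+ 2) - Psi (- y ^+ 2) - 2 / 3 * kappa * y ^+ 3| <= 12 * K * s ^+ 2.
  move=> y0 ys; have y20 := sqr_ge0 y.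
  have Ls t : `|t| <= y ^+ 2 ->
      `|poisson_sum n a c e t - kappa * Num.sqrt t| <= 3 * K * s.
    move=> ty; apply: le_trans (approx t _ _) _.
    - by clear -ty ys s2s ss0 sp; lra.
    - by clear -s2s ss0 sp; lra.
    rewrite (_ : 3 * K * s = K * (3 * s)); last by ring.
    by rewrite ler_wpM2l//; clear -ty ys s2s sp; lra.
  have h1 := atan_sum_sqr_le (n := n) (a := a) (c := c) (L := 3 * K * s) e0 y0.
  have {}h1 : `|Psi (y ^+ 2) - Psi 0 - 2 / 3 * kappa * y ^+ 3| <= 3 * K * s * y ^+ 2.
    by apply: h1 => t t0 ty; apply: Ls; rewrite ger0_norm.
  have h2 := atan_sum_neg_le (n := n) (a := a) (c := c) (L := 3 * K * s) e0 y20.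
  have {}h2 : `|Psi 0 - Psi (- y ^+ 2)| <= 3 * K * s * y ^+ 2.
    apply: h2 => t t0 ty; have := Ls t; rewrite ler0_sqrtr// mulr0 subr0; apply.
    by rewrite ler0_norm//; lra.
  rewrite (_ : _ - _ = (Psi (y ^+ 2) - Psi 0 - 2 / 3 * kappa * y ^+ 3) +
    (Psi 0 - Psi (- y ^+ 2))); last by ring.
  rewrite (le_trans (ler_normD _ _))// (le_trans (lerD h1 h2))//.
  have Ks : 0 <= K * s by rewrite mulr_ge0// ltW.
  have : K * s * y ^+ 2 <= K * s * (2 * s) by rewrite ler_wpM2l//; lra.
  by rewrite [s ^+ 2]expr2; lra.
have YE : s ^+ 2 / e = (s ^+ 2)^-1.
  by rewrite /e expr2 invfM mulrA divff ?mul1r// gt_eqF.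
have Y0 : 0 < (s ^+ 2)^-1 by rewrite invr_gt0.
have atY : pi / 2 - s ^+ 2 <= atan (s ^+ 2)^-1.
  by have := atan_ge Y0; rewrite invrK.
have atY2 : pi / 2 - 2 * s ^+ 2 <= atan ((s ^+ 2)^-1 / 2).
  by have := atan_ge (divr_gt0 Y0 (ltr0n R 2)); rewrite invf_div invrK.
have iee : 0 < e^-1 by rewrite invr_gt0.
(* A cell with b k != 0 has - h <= c k <= s, so both ends of the widened window are at distance at
   least s^2 from c k, and its arctangent difference is at least pi - 2 s^2. *)
have upper : N s * (pi - 2 * s ^+ 2) <= Psi (s + s ^+ 2) - Psi (- (s + s ^+ 2)).
  rewrite /Psi atan_sum_diff bN mulr_suml; apply: ler_sum => k _.
  have /andP[b0 bk] := ba k.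
  set A1 := atan _; set A2 := atan _.
  have A12 : A2 <= A1.
    by rewrite le_atan// ler_pM2r//; clear -s2p sp; lra.
  have [->|bn] := eqVneq (b k) 0; first by rewrite mul0r mulr_ge0// subr_ge0.
  have ck : c k <= s by rewrite leNgt; apply/negP => /bout e1; rewrite e1 eqxx in bn.
  have ck' : 0 <= c k + h.
    rewrite leNgt; apply/negP => /aneg ak; move: bn.
    by rewrite eq_le b0 andbT -ak bk.
  have B1 : atan (s ^+ 2)^-1 <= A1.
    by rewrite le_atan// -YE ler_pM2r//; clear -ck; lra.
  have B2 : A2 <= - atan (s ^+ 2)^-1.
    by rewrite -atanN le_atan// -YE -mulNr ler_pM2r//; clear -ck' hs s2s sp; lra.
  apply: (@le_trans _ _ (b k * (A1 - A2))).
    by rewrite ler_wpM2l//; clear -B1 B2 atY; lra.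
  by rewrite ler_wpM2r// subr_ge0.
(* A cell ending at or below s contributes at most pi a k = pi b k. Any other has c k > s - h, hence
   lies at least s^2 / 2 to the right of the narrowed window and contributes at most 2 s^2 a k. *)
have lower : Psi (s - s ^+ 2) - Psi (- (s - s ^+ 2)) <= N s * pi + 2 * s ^+ 2.
  have E2 : 2 * s ^+ 2 = \sum_(k < n) a k * (2 * s ^+ 2).
    by rewrite -mulr_suml a1 mul1r.
  rewrite /Psi atan_sum_diff [in leRHS]E2 bN mulr_suml -big_split/=.
  apply: ler_sum => k _; have /andP[b0 bk] := ba k.
  set A1 := atan _; set A2 := atan _.
  have l1 : A1 < pi / 2 by exact: atan_ltpi2.
  have l2' : - (pi / 2) < A2 by exact: atan_gtNpi2.
  case: (leP (c k + h) s) => [/bin ->|ck].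
    have h1 : a k * (A1 - A2) <= a k * pi.
      by rewrite ler_wpM2l//; clear -l1 l2'; lra.
    by have := mulr_ge0 (a0 k) (ltW s2p); clear -h1; lra.
  have B1 : A1 <= - atan ((s ^+ 2)^-1 / 2).
    have YE2 : - ((s ^+ 2)^-1 / 2) = - (s ^+ 2 / 2) / e by rewrite -YE; ring.
    by rewrite -atanN le_atan// YE2 ler_pM2r//; clear -ck hs; lra.
  apply: (@le_trans _ _ (a k * (2 * s ^+ 2))).
    by rewrite ler_wpM2l//; clear -B1 l2' atY2; lra.
  by rewrite lerDr mulr_ge0// ltW.
have [yp [ym [[yp0 ym0] [yp2 ym2] yp3 ym3]]] := sqrt_cube_perturb sp s12.
have mp := main yp yp0; rewrite yp2 in mp.
have mm := main ym ym0; rewrite ym2 in mm.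
have {}mp := mp (lexx _).
have {}mm : `|Psi (s - s ^+ 2) - Psi (- (s - s ^+ 2)) - 2 / 3 * kappa * ym ^+ 3|
    <= 12 * K * s ^+ 2 by apply: mm; clear -s2p; lra.
set q3 := Num.sqrt s ^+ 3 in yp3 ym3 *.
move: mp mm; rewrite !ler_norml => /andP[_ mp] /andP[mm _].
have kyp := ler_wpM2l (ltW kp) yp3; have kym := ler_wpM2l (ltW kp) ym3.
have Ns2 : N s * s ^+ 2 <= s ^+ 2 by rewrite ler_piMl// ltW.
have ks2 : 0 <= kappa * s ^+ 2 by rewrite mulr_ge0 // ltW.
(* 2 kappa is (2/3) kappa times the 3 s^2 of [yp3], 12 K comes from [main], and 2 from the defect 2
   s^2 of [upper], as N s <= 1. *)
have up : N s * pi - 2 / 3 * kappa * q3 <= (2 * kappa + 12 * K + 2) * s ^+ 2.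
  by clear -upper mp kyp Ns2; lra.
have lo : - ((2 * kappa + 12 * K + 2) * s ^+ 2) <= N s * pi - 2 / 3 * kappa * q3.
  by clear -lower mm kym ks2; lra.
rewrite (_ : N s - _ = (N s * pi - 2 / 3 * kappa * q3) / pi); last first.
  by rewrite mulrBl mulfK ?gt_eqF//; congr (_ - _); rewrite mulrAC.
rewrite -ler_norml normrM normfV (gtr0_norm pi0) [leRHS]mulrAC ler_pM2r ?invr_gt0//.
by rewrite ler_norml lo up.
Qed.

End RealAnalysis.

(** * The spectral distribution function *)

Section Assembly.
Variable R : realType.
Notation X := (orbit_half R).
Notation C := R[i].
Notation nrm := (@Normc.normc R).

Lemma delta_point (f : C -> R) : f 0 = 0 ->
  rsummable (fun y : X => f (delta_half R y)) /\
  rsum (fun y : X => f (delta_half R y)) = f 1.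
Proof.
move=> f0; have [s e] : rsummable (fun y : X => f (delta_half R y)) /\
  rsum (fun y : X => f (delta_half R y)) = f (delta_half R (base_point R)).
  by apply: rsum_point => y; rewrite /delta_half => /negbTE ->.
by rewrite e /delta_half eqxx.
Qed.

Lemma delta_l2 : l2 (delta_half R).
Proof.
apply/l2E; have [|s _] := @delta_point (fun c => redot c c); last exact: s.
by rewrite /redot /= mulr0 addr0.
Qed.

Lemma rinner_delta : rinner (delta_half R) (delta_half R) = 1.
Proof.
have [|_ e] := @delta_point (fun c => redot c c).
  by rewrite /redot /= mulr0 addr0.
by rewrite /rinner e /redot /= mulr1 mulr0 addr0.
Qed.

Lemma rinner_i_delta (u : X -> C) :
  rinner u ('i%C *: delta_half R) = complex.Im (u (base_point R)).
Proof.
have [_ ->] : rsummable (fun y : X => redot (u y) (('i%C *: delta_half R) y)) /\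
  rinner u ('i%C *: delta_half R) = redot (u (base_point R))
    (('i%C *: delta_half R) (base_point R)).
  apply: rsum_point => y y0.
  have -> : ('i%C *: delta_half R) y = 'i%C * delta_half R y by [].
  by rewrite /delta_half (negbTE y0) mulr0 /redot /= !mulr0 addr0.
have -> : ('i%C *: delta_half R) (base_point R) = 'i%C * 1.
  transitivity ('i%C * delta_half R (base_point R)) => //.
  by rewrite /delta_half eqxx.
by rewrite mulr1 /redot /=; ring.
Qed.

(** Pair the resolvent equation with [u]: (u, T u) is real, so only Im z = [e] contributes to the
    imaginary part. *)
Lemma Im_resolvent (u : X -> C) (t e : R) : l2 u ->
  laplace R u - Complex t e *: u = delta_half R ->
  complex.Im (u (base_point R)) = e * rinner u u.
Proof.
move=> lu ud; have lT := laplace_l2 lu; have liu := l2Z 'i%C lu.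
have lz := l2Z (Complex t e) lu; have liT := l2Z 'i%C lT.
rewrite -rinner_i_delta -ud scalerBr scalerA.
have -> : 'i%C * Complex t e = t%:C%C * 'i%C + (- e)%:C%C.
  by apply/eqP; rewrite eq_complex /=; apply/andP; split; apply/eqP; ring.
rewrite scalerDl -scalerA.
have ltiu := l2Z t%:C%C liu; have leu := l2Z (- e)%:C%C lu.
rewrite (rinnerBr liT (l2D ltiu leu) lu) (rinnerDr ltiu leu lu).
rewrite (rinnerZr _ liu lu) (rinnerZr _ lu lu).
have iu0 : rinner u ('i%C *: u) = 0.
  by have := rinner_iC lu lu; rewrite rinnerC; lra.
have iT0 : rinner u ('i%C *: laplace R u) = 0.
  have := rinner_iC lT lu; rewrite -(laplace_sym liu lu) laplace_scale.
  by rewrite rinnerC; lra.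
by rewrite iu0 iT0; ring.
Qed.

(** s = sqrt ((m - t) / 2) - i sqrt ((m + t) / 2) with m = |t + i e|. As [Num.sqrt t] is 0 for t <
    0, the last bound covers both signs of t. *)
Lemma sqrtc_upper (t e : R) : 0 < e ->
  let s := sqrtc (Complex (- t) (- e)) in
  [/\ - s ^+ 2 = Complex t e, 0 < complex.Re s,
      nrm s ^+ 2 <= `|t| + e & `|complex.Im s + Num.sqrt t| <= Num.sqrt e].
Proof.
move=> e0 s; have s2 : s ^+ 2 = Complex (- t) (- e) by exact: sqr_sqrtc.
pose m := Num.sqrt (t ^+ 2 + e ^+ 2).
have p0 : 0 <= t ^+ 2 + e ^+ 2 by rewrite addr_ge0 ?sqr_ge0.
have m2 : m ^+ 2 = t ^+ 2 + e ^+ 2 by rewrite sqr_sqrtr.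
have m0 : 0 <= m by exact: sqrtr_ge0.
have te : 0 <= `|t| + e by rewrite addr_ge0// ltW.
have tn : t ^+ 2 = `|t| ^+ 2 by rewrite real_normK// num_real.
have mt : `|t| < m.
  rewrite -(ltr_pXn2r (n := 2)) ?nnegrE// m2 tn ltrDl exprn_gt0//.
have mte : m <= `|t| + e.
  rewrite -(ler_pXn2r (n := 2)) ?nnegrE// m2 tn sqrrD.
  have := mulr_ge0 (normr_ge0 t) (ltW e0).
  by rewrite -mulr_natl; lra.
have e1 : Num.sqrt e ^+ 2 = e by rewrite sqr_sqrtr// ltW.
have e2 : 0 <= Num.sqrt e by exact: sqrtr_ge0.
have ts := ler_norm t; have ts' := ler_norm (- t); rewrite normrN in ts'.
split.
- by rewrite s2; apply/eqP; rewrite eq_complex /= !opprK !eqxx.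
- rewrite /s /= sqrtr_gt0 !sqrrN -/m; lra.
- by rewrite -nrmX s2 /= !sqrrN -/m.
have -> : complex.Im s = - Num.sqrt ((m + t) / 2).
  rewrite /s /= oppr_eq0 (gt_eqF e0) !sqrrN -/m opprK.
  by rewrite ltr0_sg ?oppr_lt0// mulN1r.
set w := Num.sqrt ((m + t) / 2).
have w0 : 0 <= w by exact: sqrtr_ge0.
have w2 : w ^+ 2 = (m + t) / 2 by rewrite sqr_sqrtr//; lra.
have [tneg|tpos] := ltP t 0.
  rewrite ler0_sqrtr ?(ltW tneg)// addr0 normrN ger0_norm//.
  rewrite -(ler_pXn2r (n := 2)) ?nnegrE// w2 e1.
  by move: mte; rewrite ltr0_norm//; lra.
have st0 : 0 <= Num.sqrt t by exact: sqrtr_ge0.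
have st2 : Num.sqrt t ^+ 2 = t by rewrite sqr_sqrtr.
have wt : Num.sqrt t <= w.
  by rewrite -(ler_pXn2r (n := 2)) ?nnegrE// w2 st2; lra.
have wte : w <= Num.sqrt t + Num.sqrt e.
  rewrite -(ler_pXn2r (n := 2)) ?nnegrE ?addr_ge0// w2 sqrrD st2 e1.
  have := mulr_ge0 st0 e2; rewrite -mulr_natl.
  by move: mte; rewrite ger0_norm//; lra.
by rewrite ler_norml; apply/andP; split; lra.
Qed.

Lemma resolvent_near0 : exists kappa K s0 : R,
  [/\ 0 < kappa, 0 <= K, 0 < s0, s0 <= 1 &
   forall t e : R, `|t| <= s0 -> 0 < e -> e <= s0 -> exists u : X -> C,
    [/\ l2 u, laplace R u - Complex t (e ^+ 2) *: u = delta_half R &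
        `|complex.Im (u (base_point R)) - kappa * Num.sqrt t| <= K * (`|t| + e)]].
Proof.
have [kappa [K [r [k0 K0 r0 H]]]] := resolvent_parameters R.
(* The extra kappa pays for replacing - Im s by sqrt t, at a cost of sqrt (e^2) = e; r^2 / 2 ensures
   |s|^2 <= |t| + e^2 <= r^2. *)
exists kappa, (K + kappa), (Num.min (1 / 2) (r ^+ 2 / 2)); split => //.
- by rewrite addr_ge0// ltW.
- by rewrite lt_min !divr_gt0// exprn_gt0.
- by rewrite ge_min; apply/orP; left; lra.
move=> t e; rewrite !le_min => /andP[t1 t2] e0 /andP[e1 e2].
have ee : e ^+ 2 <= e by rewrite expr2 ler_piMr ?(ltW e0)//; lra.
have ee0 : 0 < e ^+ 2 by rewrite exprn_gt0.
have [] := sqrtc_upper t ee0; set s := sqrtc _ => sz s0 sn sI.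
have sr : nrm s <= r.
  rewrite -(ler_pXn2r (n := 2)) ?nnegrE ?nrm_ge0 ?(ltW r0)//; lra.
have [p [q [w [v [G [[p0 q0 p1 q1 vw] hp hq [hw hv hG] hI]]]]]] := H s s0 sr.
rewrite sz in hp hq.
exists (fun y : X => tree_fun p q w v G (pt y)); split.
- exact: (tree_fun_l2 G p1 q1 vw).
- exact: (tree_fun_resolvent p0 q0 hp hq hw hv hG).
have -> : pt (base_point R) = 1 / 2 by [].
rewrite tree_fun_half.
rewrite (_ : _ - _ = (complex.Im G + kappa * complex.Im s) -
  kappa * (complex.Im s + Num.sqrt t)); last by ring.
rewrite (le_trans (ler_normB _ _))// normrM (gtr0_norm k0).
rewrite sqrtr_sqr (ger0_norm (ltW e0)) in sI.
have h1 : K * nrm s ^+ 2 <= K * (`|t| + e) by rewrite ler_wpM2l//; lra.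
have h2 := ler_wpM2l (ltW k0) sI.
have h3 := mulr_ge0 (ltW k0) (normr_ge0 t); lra.
Qed.

Section SpectralDistribution.
Variable E : set (measurableTypeR R) -> (X -> C) -> (X -> C).
Hypothesis hE : spectral_resolution (laplace R) E.

(** Supplies the hypothesis of [stieltjes_asymptotics]. The mesh e^4 is the square of the imaginary
    part e^2, as [cell_resolvent] requires. *)
Lemma spectral_partition (kappa K s0 e : R) : 0 < kappa -> 0 <= K -> s0 <= 1 ->
  (forall t e : R, `|t| <= s0 -> 0 < e -> e <= s0 -> exists u : X -> C,
    [/\ l2 u, laplace R u - Complex t (e ^+ 2) *: u = delta_half R &
        `|complex.Im (u (base_point R)) - kappa * Num.sqrt t| <= K * (`|t| + e)]) ->
  0 < e -> e <= 1 -> exists n (a c : nat -> R),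
  [/\ forall k, 0 <= a k, \sum_(k < n) a k = 1,
     forall k, c k + e ^+ 4 < 0 -> a k = 0,
     forall s, exists b : nat -> R,
       [/\ spectral_measure E (delta_half R) [set` `]-oo, s]] = \sum_(k < n) b k,
         forall k, 0 <= b k <= a k, forall k, s < c k -> b k = 0 &
         forall k, c k + e ^+ 4 <= s -> b k = a k] &
     forall t : R, `|t| <= s0 -> e <= s0 ->
       `|poisson_sum n a c (e ^+ 2) t - kappa * Num.sqrt t| <=
         (7 * K + 3 * kappa) * (`|t| + e)].
Proof.
move=> k0 K0 s01 H e0 e1; have ld := delta_l2.
have [r r0 hr] := E_bounded hE.
set h := e ^+ 4; have h0 : 0 < h by rewrite exprn_gt0.
pose n := Num.bound (2 * r / h).
have nh : 2 * r < n%:R * h.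
  rewrite -ltr_pdivrMr//; apply: archi_boundP.
  by rewrite divr_ge0 ?mulr_ge0// ltW.
have covers : exists r', [/\ - r <= - r', r' < - r + n%:R * h &
    forall f, l2 f -> E [set` `[- r', r']] f = f].
  by exists r; split => //; lra.
pose B k := cell (- r) h k.
have mB k : measurable (B k) by exact: measurable_cell.
have ck k : - r + k.+1%:R * h = - r + k%:R * h + h by rewrite -natr1; ring.
have Bch k x : B k x -> - r + k%:R * h <= x <= - r + k%:R * h + h.
  by rewrite /B /cell /= in_itv/= ck => /andP[-> /ltW ->].
pose a k := rinner (E (B k) (delta_half R)) (E (B k) (delta_half R)).
exists n, a, (fun k => - r + k%:R * h); split.
- by move=> k; apply: rinner_ge0; exact: (E_l2 hE).
- by rewrite -(sum_cell hE (ltW h0) covers ld) rinner_delta.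
- move=> k neg; have dp : 0 < - (- r + k%:R * h + h) by rewrite oppr_gt0.
  have Bneg : B k `<=` [set` `]-oo, - - (- r + k%:R * h + h)]].
    by move=> x /Bch/andP[_ xk]; rewrite /= in_itv/= opprK.
  have mneg : measurable ([set` `]-oo, - - (- r + k%:R * h + h)]] : set (measurableTypeR R)).
    exact: measurable_itv.
  rewrite /a -(E_subset hE (mB k) mneg Bneg ld).
  rewrite (E_below0 hE (@laplace_ge0 R) dp ld) (E_0 hE)// rinner0l//; exact: l20.
- move=> s; have [b [b1 b2 b3 b4]] := cell_below hE (ltW h0) covers s ld.
  by exists b; split => // k; rewrite -ck; exact: b4.
move=> t ts es; have [u [lu ud uI]] := H t e ts e0 es.
have e20 : 0 < e ^+ 2 by rewrite exprn_gt0.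
have ee : e ^+ 2 <= e by rewrite expr2 ler_piMr// ltW.
have e21 : e ^+ 2 <= 1 by lra.
have hee : h = (e ^+ 2) ^+ 2 by rewrite /h; ring.
have ImE := Im_resolvent lu ud.
set I := complex.Im _ in uI ImE.
have I0 : 0 <= I by rewrite ImE mulr_ge0 ?rinner_ge0// ltW.
have close : `|poisson_sum n a (fun k => - r + k%:R * h) (e ^+ 2) t - I| <=
    3 * e ^+ 2 * I.
  rewrite {1}ImE {1}(sum_cell hE (ltW h0) covers lu) mulr_sumr /poisson_sum -sumrB.
  rewrite ImE [in leRHS](sum_cell hE (ltW h0) covers lu) !mulr_sumr.
  rewrite (le_trans (ler_norm_sum _ _ _))//; apply: ler_sum => k _.
  exact: (cell_resolvent hE (@laplace_l2 R) (@laplace_add R) (@laplace_scale R)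
    (@laplace_sym R) (mB k) e20 e21 hee (@Bch k) lu ud).
have t0 : 0 <= `|t| by [].
have st1 : Num.sqrt t <= 1.
  rewrite -[leRHS]sqrtr1; apply: ler_wsqrtr.
  by have := ler_norm t; lra.
have Ibound : I <= kappa + 2 * K.
  have h1 : kappa * Num.sqrt t <= kappa by rewrite ler_piMr// ltW.
  have h2 : K * (`|t| + e) <= K * 2 by rewrite ler_wpM2l//; lra.
  by move: uI; rewrite ler_norml => /andP[_]; lra.
rewrite (_ : _ - _ = (poisson_sum n a (fun k => - r + k%:R * h) (e ^+ 2) t - I) +
  (I - kappa * Num.sqrt t)); last by ring.
rewrite (le_trans (ler_normD _ _))//.
(* Together with the K of the expansion, 3 (kappa + 2 K) makes up 7 K + 3 kappa. *)
have h3 : 3 * e ^+ 2 * I <= 3 * e * (kappa + 2 * K).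
  by apply: ler_pM => //; [rewrite mulr_ge0// ltW|lra].
have := mulr_ge0 K0 t0; have := mulr_ge0 (ltW k0) t0; lra.
Qed.

End SpectralDistribution.

End Assembly.

Theorem proposition4 (R : realType)
    (E : set (measurableTypeR R) ->
         (orbit_half R -> R[i]) -> (orbit_half R -> R[i]))
    (hE : spectral_resolution (laplace R) E) :
  let eta := spectral_measure E (delta_half R) in
  let N := fun s : R => eta [set` `]-oo, s]] in
  exists C : R, 0 < C /\
    N = (fun s : R => C * s `^ (3 / 2)) +O_ (0^'+) (fun s : R => s ^+ 2).
Proof.
move=> eta N; have [kappa [K [s0 [k0 K0 s00 s01 H]]]] := resolvent_near0 R.
have K'0 : 0 <= 7 * K + 3 * kappa by rewrite addr_ge0// mulr_ge0// ltW.
have [C [C0 [M [s1 [s10 HN]]]]] := stieltjes_asymptotics k0 K'0 s00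
  (fun e e0 e1 => spectral_partition hE k0 K0 s01 H e0 e1).
exists C; split => //; apply/eqaddOP; near=> k; near=> s.
have sp : 0 < s by near: s; exact: nbhs_right_gt.
have ss : s <= s1 by near: s; exact: nbhs_right_le.
have powE : s `^ (3 / 2) = Num.sqrt s ^+ 3.
  rewrite (_ : 3 / 2 = 2^-1 * 3%:R); last by rewrite mulrC.
  by rewrite powRrM powR12_sqrt ?(ltW sp)// powR_mulrn// sqrtr_ge0.
have -> : (N - (fun s : R => C * s `^ (3 / 2))) s = N s - C * Num.sqrt s ^+ 3.
  by rewrite -powE.
apply: (le_trans (HN s sp ss)); rewrite (ger0_norm (sqr_ge0 s)) ler_wpM2r ?sqr_ge0//.
Unshelve. all: by end_near.
Qed.
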